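(* Consider the Calabi-Yau $A_\infty$ category of matrix factorizations of $\frac1{n+1}x^{n+1}$, represented by its minimal model $A_n$, with its versal deformation $\mathcal A_n$ and the (unique up to scalars) categorical primitive form $\zeta\in HC^-_*(\mathcal A_n)$ lifting $\omega$. Then the categorical genus zero invariants computed from $(\mathcal A_n,\zeta)$ agree with the corresponding invariants obtained through Saito's procedure of unfolding of singularities of $\frac1{n+1}x^{n+1}$, using the (unique up to scalar) primitive form $dx$. That is, under the identification $$\Phi: HH_{*+1}(A_n)\cong\mathbb{K}[x]/(x^n),\qquad \Phi([\epsilon|\epsilon^i])=x^{n-1-i},$$ one has for all $m\ge 2$ and all $0\le i_1,\dots,i_m\le n-1$ $$\langle \Phi^{-1}(x^{i_1}),\dots,\Phi^{-1}(x^{i_m})\rangle^{\rm cat}=\langle x^{i_1},\dots,x^{i_m}\rangle^{\rm Saito}.$$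
   Context: $\mathbb{K}$ is a field of characteristic $0$ and $n\ge 1$ an integer. Shifted sign conventions are used for $A_\infty$ algebras (all structure maps $\mu_k$, $k\ge 0$, have degree $1$ with respect to the shifted grading, and all signs $\pm$ below are the resulting Koszul signs). Hochschild chains are graded homologically. **The algebra $A_n$.** $A_n=\mathrm{span}(\mathbf 1,\epsilon)$ is the $\mathbb{Z}/2\mathbb{Z}$-graded $A_\infty$ algebra with $\mathbf 1$ even and a strict unit, $\epsilon$ odd, whose only other non-zero operation is $\mu_{n+1}(\epsilon,\dots,\epsilon)=\frac1{n+1}\mathbf 1$. It is cyclic for the odd pairing with $\langle\mathbf 1,\epsilon\rangle=1$. It is the minimal model of the endomorphism dg algebra of the generator of the category of matrix factorizations of $\frac1{n+1}x^{n+1}$. **The versal deformation.** $R=\mathbb{K}[[t_0,\dots,t_{n-1}]]$, with maximal ideal $\mathfrak m$. $\mathcal A_n=A_n\otimes R$ is the weakly curved $A_\infty$ algebra over $R$ with strict unit $\mathbf 1$ and $\mu_0=t_0\mathbf 1$, $\mu_k(\epsilon^{\otimes k})=t_k\mathbf 1$ for $1\le k\le n-1$, $\mu_{n+1}(\epsilon^{\otimes n+1})=\frac1{n+1}\mathbf 1$. The pairing of $A_n$ is extended $R$-linearly. **Chains.** $CC_*$ denotes the reduced Hochschild chain complex (the unit is killed in all slots except the $0$-th), with Hochschild differential $b$ and Connes operator $B$; chains are written $a_0|a_1|\cdots|a_k$, and $\epsilon|\epsilon^k$ has $k$ copies of $\epsilon$ after the bar. For $\mathcal A_n$, $CC_*(\mathcal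 A_n):=\varprojlim_N CC_*(\mathcal A_n/\mathfrak m^N\mathcal A_n)$. $HC^-_*$ is the homology of $(CC_*[[u]],b+uB)$ and $HP_*$ that of $(CC_*((u)),b+uB)$ ($\mathfrak m$-adically completed for $\mathcal A_n$). $HH_*$ is Hochschild homology, $HH_{*+1}$ its shift by one, and $\pi:HC^-_*\to HH_*$ sets $u=0$. $HH_*(A_n)$ has basis $[\epsilon|\epsilon^k]$, $0\le k\le n-1$. **Mukai and higher residue pairings.** Put $c(a_1,\dots,a_{k+1})=\langle\mu_k(a_1,\dots,a_k),a_{k+1}\rangle$, let $\{e_s\}$ be a basis of the algebra over the ground ring and $\{e^s\}$ the dual basis for the pairing. Then $$\langle a_0|\cdots|a_i,\,b_0|\cdots|b_j\rangle_{\rm Muk}=\sum\pm\, c(a_{q+1},\dots,a_i,a_0,\dots,a_p,e_s,b_{p'+1},\dots,b_{q'},e_t)\;c(b_{q'+1},\dots,b_j,b_0,\dots,b_{p'},e^s,a_{p+1},\dots,a_q,e^t),$$ summed over $0\le p\le q\le i$, $0\le p'\le q'\le j$, and $s,t$; and $\langle \alpha u^i,\beta u^j\rangle_{\rm hres}=(-1)^i\langle\alpha,\beta\rangle_{\rm Muk}u^{i+j}$. **Connections.** For a Hochschild cochain $\varphi$, $$b^{1|1}(\varphi;a_0|\cdots|a_k)=\sum_{0\le j\le p\le q\le r\le k}\pm\mu(a_{p+1},\dots,a_q,\varphi(a_{q+1},\dots,a_r),a_{r+1},\dots,a_k,a_0,\dots,a_j)|a_{j+1}|\cdots|a_p,$$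 $$B^{1|1}(\varphi;a_0|\cdots|a_k)=\sum_{0\le p\le q\le r\le k}\pm\mathbf 1|a_{p+1}|\cdots|a_q|\varphi(a_{q+1},\dots,a_r)|a_{r+1}|\cdots|a_k|a_0|\cdots|a_p.$$ For $v\in\mathrm{Der}(R)$, $\mathrm{KS}(v)\in HH^*(\mathcal A_n)$ is the class of $v(\mu)$, and $\nabla_v=v-u^{-1}b^{1|1}(v(\mu);-)-B^{1|1}(v(\mu);-)$ (Getzler-Gauss-Manin connection). $\mathrm{KS}:\mathrm{Der}(R)\to HH^*(\mathcal A_n)$ is an isomorphism. With $\Gamma(a_0|\cdots|a_k)=-k\,a_0|\cdots|a_k$ and $\kappa=\prod_k(2-k)\mu_k$, $$\nabla_{\partial/\partial u}=\frac{\partial}{\partial u}+\frac{\Gamma}{2u}+\frac{B^{1|1}(\kappa;-)}{2u}+\frac{b^{1|1}(\kappa;-)}{2u^2},\qquad \nabla_{u\partial/\partial u}=u\nabla_{\partial/\partial u}.$$ **Categorical primitive form.** Let $\omega=\sum_{l\ge0}(-1)^lc_l\,\epsilon|\epsilon^{n-1+nl+l}u^l\in HC_*^-(A_n)$ with $c_0=1$, $c_l=\prod_{j=0}^{l-1}(n+j(n+1))$. $\zeta\in HC^-_*(\mathcal A_n)$ is the unique element such that: (P0) $\zeta|_{t=0}=\omega$; (P1) $\mathrm{Der}(R)\to HC^-_*(\mathcal A_n)/u\,HC^-_*(\mathcal A_n)=HH_*(\mathcal A_n)$, $v\mapsto\pi(u\nabla_v\zeta)$, is an isomorphism; (P2)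 $\langle u\nabla_{v_1}\zeta,u\nabla_{v_2}\zeta\rangle_{\rm hres}\in R$; (P3) $\langle u\nabla_{v_1}u\nabla_{v_2}\zeta,u\nabla_{v_3}\zeta\rangle_{\rm hres}\in R\oplus uR$, for all $v_i\in\mathrm{Der}(R)$; (P4) with $E=\mathrm{KS}^{-1}([\mu])$ there is a constant $r\in\mathbb K$ with $(\nabla_{u\partial/\partial u}+\nabla_E)\zeta=r\zeta$. (Existence and uniqueness of $\zeta$ may be assumed.) **Categorical genus zero invariants.** The metric $g(v_1,v_2)=\langle u\nabla_{v_1}\zeta,u\nabla_{v_2}\zeta\rangle_{\rm hres}$ on $\mathrm{Der}(R)$ is flat. Let $\tau_0,\dots,\tau_{n-1}$ be the flat coordinates with $\tau_k=-t_k+O(t^2)$. The genus zero potential $\mathcal F^{\rm cat}\in\mathbb K[[\tau_0,\dots,\tau_{n-1}]]$ is defined (modulo terms of degree $\le2$) by $$\frac{\partial^3\mathcal F^{\rm cat}}{\partial\tau_i\partial\tau_j\partial\tau_k}=\big\langle u\nabla_{\partial/\partial\tau_i}u\nabla_{\partial/\partial\tau_j}\zeta,\;u\nabla_{\partial/\partial\tau_k}\zeta\big\rangle_{\rm hres}\Big|_{u=0}.$$ For $m\ge3$ the invariant $\langle\Phi^{-1}(x^{i_1}),\dots,\Phi^{-1}(x^{i_m})\rangle^{\rm cat}$ is $\partial_{\tau_{i_1}}\cdots\partial_{\tau_{i_m}}\mathcal F^{\rm cat}|_{\tau=0}$; for $m=2$ it is $g(\partial_{\tau_{i_1}},\partial_{\tau_{i_2}})$.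 **Saito's genus zero invariants.** Let $F(x,t)=\frac1{n+1}x^{n+1}+\sum_{j=0}^{n-1}t_jx^j$ be the universal unfolding, let $\mathcal H=R[x][[u]]\,dx\big/\,(u\,d-dF\wedge)\big(R[x][[u]]\big)$ ($d$ the differential in $x$, everything completed $\mathfrak m$-adically) be the Brieskorn lattice, with Gauss-Manin connection $\nabla_{\partial/\partial t_i}=\frac{\partial}{\partial t_i}-u^{-1}x^i$ and K. Saito's higher residue pairing, which is $u$-sesquilinear with leading term $\langle g\,dx,h\,dx\rangle|_{u=0}=\mathrm{Res}\,\frac{gh\,dx}{\partial_xF}$ (global Grothendieck residue). The element $\zeta=dx$ is a primitive form. The flat metric, flat coordinates $\tau_k=-t_k+O(t^2)$, potential $\mathcal F^{\rm Saito}$ and invariants $\langle x^{i_1},\dots,x^{i_m}\rangle^{\rm Saito}$ are defined from $\zeta=dx$ by exactly the same formulas as in the categorical case. In this normalization $\langle x^i,x^j\rangle=\delta_{i+j=n-1}$ and $\langle x^i,x^j,x^k\rangle=\delta_{i+j+k=n-1}$. *)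

(* Defs.v *)
Set Warnings "-notation-overridden,-ambiguous-paths,-notation-incompatible-prefix".
From HB Require Import structures.
From mathcomp Require Import all_boot all_order all_algebra.
From mathcomp Require Import boolp classical_sets functions cardinality.
From mathcomp Require Import fsbigop mpoly.
Set Implicit Arguments.
Unset Strict Implicit.
Unset Printing Implicit Defensive.
Import Order.TTheory GRing.Theory.
Local Open Scope ring_scope.

(* A[[t_0, ..., t_(n-1)]]; f m is the coefficient of t^m. *)
Record mps (n : nat) (A : Type) := Mps { mps_coef :> 'X_{1..n} -> A }.

Lemma mpsP n A (f g : mps n A) : (forall m, f m = g m) -> f = g.
Proof. by case: f g => f [g] /= /funext ->. Qed.

HB.instance Definition _ n A := gen_eqMixin (mps n A).
HB.instance Definition _ n A := gen_choiceMixin (mps n A).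

Section MpsZmod.
Variables (n : nat) (A : zmodType).
Implicit Types f g h : mps n A.

Definition mps_zero : mps n A := Mps (fun _ => 0).
Definition mps_opp f : mps n A := Mps (fun m => - f m).
Definition mps_add f g : mps n A := Mps (fun m => f m + g m).

Fact mps_addA : associative mps_add.
Proof. by move=> f g h; apply: mpsP => m /=; rewrite addrA. Qed.
Fact mps_addC : commutative mps_add.
Proof. by move=> f g; apply: mpsP => m /=; rewrite addrC. Qed.
Fact mps_add0 : left_id mps_zero mps_add.
Proof. by move=> f; apply: mpsP => m /=; rewrite add0r. Qed.
Fact mps_addN : left_inverse mps_zero mps_opp mps_add.
Proof. by move=> f; apply: mpsP => m /=; rewrite addNr. Qed.

HB.instance Definition _ :=
  GRing.isZmodule.Build (mps n A) mps_addA mps_addC mps_add0 mps_addN.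
End MpsZmod.

Section MpsRing.
Variables (n : nat) (A : comNzRingType).
Implicit Types f g h : mps n A.

Definition mpsC (c : A) : mps n A := Mps (fun m => if m == 0%MM then c else 0).
Definition mpsX (j : 'I_n) : mps n A := Mps (fun m => (m == U_(j)%MM)%:R).

Definition mps_mul f g : mps n A :=
  Mps (fun m => \sum_(k : 'X_{1..n < (mdeg m).+1, (mdeg m).+1}
                       | m == (k.1 + k.2)%MM) f k.1 * g k.2).

Let trunc N f : {mpoly A[n]} := \sum_(m : 'X_{1..n < N}) f m *: 'X_[m].

Let truncE N f (m : 'X_{1..n}) : (mdeg m < N)%N -> (trunc N f)@_m = f m.
Proof. exact: mcoeff_mpoly. Qed.

Let mulE N f g (m : 'X_{1..n}) :
  (mdeg m < N)%N -> mps_mul f g m = (trunc N f * trunc N g)@_m.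
Proof.
move=> ltmN; rewrite mcoeffM /=; apply: eq_bigr => k _.
by rewrite !truncE //; apply: leq_trans ltmN; apply: bmdeg.
Qed.

Let mulEl N f (p : {mpoly A[n]}) (m : 'X_{1..n}) g : (mdeg m < N)%N ->
  (forall k, (mdeg k < N)%N -> f k = p@_k) ->
  mps_mul f g m = (p * trunc N g)@_m.
Proof.
move=> ltmN fp; rewrite mcoeffM /=; apply: eq_bigr => k _.
by rewrite truncE ?fp //; apply: leq_trans ltmN; apply: bmdeg.
Qed.

Fact mps_mulC : commutative mps_mul.
Proof. by move=> f g; apply: mpsP => m; rewrite !(mulE _ _ (ltnSn _)) mulrC. Qed.

Fact mps_mulA : associative mps_mul.
Proof.
move=> f g h; apply: mpsP => m; rewrite mps_mulC.
rewrite (mulEl _ (ltnSn _) (fun k => @mulE _ g h k)).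
rewrite (mulEl _ (ltnSn _) (fun k => @mulE _ f g k)).
by rewrite mulrC mulrA.
Qed.

Fact mps_mul1 : left_id (mpsC 1) mps_mul.
Proof.
move=> f; apply: mpsP => m.
rewrite (@mulEl (mdeg m).+1 _ 1) ?ltnSn ?mul1r ?truncE //.
by move=> k _; rewrite mcoeff1 /=; case: eqP.
Qed.

Fact mps_mulDl : left_distributive mps_mul +%R.
Proof.
move=> f g h; apply: mpsP => m /=; rewrite -big_split /=.
by apply: eq_bigr => k _; rewrite mulrDl.
Qed.

Fact mps_one_neq0 : mpsC 1 != 0.
Proof.
apply/eqP => /(congr1 (fun f : mps n A => f 0%MM)) /=.
by rewrite eqxx => /eqP; rewrite oner_eq0.
Qed.

HB.instance Definition _ := GRing.Zmodule_isComNzRing.Build (mps n A)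
  mps_mulA mps_mulC mps_mul1 mps_mulDl mps_one_neq0.

Definition mps_deriv (j : 'I_n) f : mps n A :=
  Mps (fun m => f (m + U_(j))%MM *+ (m j).+1).
End MpsRing.

Definition mps_map n (A B : Type) (h : A -> B) (f : mps n A) : mps n B :=
  Mps (fun m => h (f m)).

(* The N-th power of the maximal ideal of K[[t]], and of the ideal 0 of K. *)
Definition mps_adic n (A : zmodType) (N : nat) (f : mps n A) : Prop :=
  forall m, (mdeg m < N)%N -> f m = 0.
Definition discrete_adic (A : zmodType) (N : nat) (x : A) : Prop :=
  N = 0%N \/ x = 0.

(* Parity of the Koszul sign of a permutation of homogeneous blocks; these    *)
(* are listed in their final order, each with its initial rank and parity.    *)
Fixpoint koszul (s : seq (nat * bool)) : bool :=
  if s is x :: s' then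
    (x.2 && odd (count (fun y => (y.1 < x.1)%N && y.2) s')) (+) koszul s'
  else false.

(* The data of a Z/2-graded cyclic A-infinity algebra with finite basis over R:
   mu w s is the coefficient of e_s in mu_k(e_(w_1), ..., e_(w_k)), with k the
   size of w, and dual s x that of e_x in the dual basis vector e^s. All
   parities are the shifted ones. *)
Record ainf_data (R : comNzRingType) := AinfData {
  idx : finType;
  par : idx -> bool;
  one : idx;
  mu : seq idx -> idx -> R;
  pairing : idx -> idx -> R;
  dual : idx -> idx -> R
}.
Arguments one {R} a.
Arguments par {R} a.
Arguments mu {R} a.
Arguments pairing {R} a.
Arguments dual {R} a.

(* a_(i+1), ..., a_j for l = a_1, ..., a_k *)
Definition slice T (i j : nat) (l : seq T) : seq T := take (j - i) (drop i l).

Section Hochschild.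
Variables (R : comNzRingType) (A : ainf_data R).
Local Notation I := (idx A).

(* (a_0, [:: a_1; ...; a_k]) is a_0|a_1|...|a_k *)
Definition word : Type := (I * seq I)%type.
Definition chain : Type := word -> R.
Definition lchain : Type := int -> chain.
Definition cochain : Type := seq I -> I -> R.

Definition reduced (w : word) : bool := one A \notin w.2.
Definition wpar (l : seq I) : bool := odd (count (par A) l).
Definition cyc (l : seq I) (z : I) : R := \sum_(s : I) mu A l s * pairing A s z.

(* Linear extension to (reduced) chains of an operator given on words by its  *)
(* matrix. The sums below have finite support for completed chains as soon as *)
(* mu_k = 0 for all large k.                                                  *)
Definition extend (op : word -> word -> R) (x : chain) : chain := fun w' =>
  if reduced w' then \sum_(w \in [set: word]) x w * op w w' else 0.

Definition b_word (w w' : word) : R :=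
  let: (a0, l) := w in let k := size l in
  \sum_(0 <= j < k.+1) \sum_(0 <= i < j.+1) \sum_(s : I)
    (-1) ^+ koszul [:: (1%N, wpar (a0 :: take i l)); (0%N, true)]
    * mu A (slice i j l) s * (w' == (a0, take i l ++ s :: drop j l))%:R
  + \sum_(0 <= p < k.+1) \sum_(0 <= j < p.+1) \sum_(s : I)
    (-1) ^+ koszul [:: (1%N, wpar (drop p l)); (0%N, wpar (a0 :: take p l))]
    * mu A (drop p l ++ a0 :: take j l) s * (w' == (s, slice j p l))%:R.

Definition B_word (w w' : word) : R :=
  let: (a0, l) := w in let k := size l in
  \sum_(0 <= p < k.+1)
    (-1) ^+ koszul [:: (1%N, wpar (drop p l)); (0%N, wpar (a0 :: take p l))]
    * (w' == (one A, drop p l ++ a0 :: take p l))%:R.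

(* b^{1|1}(phi;-) and B^{1|1}(phi;-) for phi homogeneous of shifted parity d *)
Definition b11_word (d : bool) (phi : cochain) (w w' : word) : R :=
  let: (a0, l) := w in let k := size l in
  \sum_(0 <= r < k.+1) \sum_(0 <= q < r.+1) \sum_(0 <= p < q.+1)
  \sum_(0 <= j < p.+1) \sum_(s : I) \sum_(s' : I)
    (-1) ^+ koszul [:: (2%N, wpar (slice p q l)); (0%N, d);
                       (3%N, wpar (drop q l)); (1%N, wpar (a0 :: take p l))]
    * phi (slice q r l) s
    * mu A (slice p q l ++ s :: drop r l ++ a0 :: take j l) s'
    * (w' == (s', slice j p l))%:R.

Definition B11_word (d : bool) (phi : cochain) (w w' : word) : R :=
  let: (a0, l) := w in let k := size l in
  \sum_(0 <= r < k.+1) \sum_(0 <= q < r.+1) \sum_(0 <= p < q.+1) \sum_(s : I)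
    (-1) ^+ koszul [:: (2%N, wpar (slice p q l)); (0%N, d);
                       (3%N, wpar (drop q l)); (1%N, wpar (a0 :: take p l))]
    * phi (slice q r l) s
    * (w' == (one A, slice p q l ++ s :: drop r l ++ a0 :: take p l))%:R.

Definition hoch_b : chain -> chain := extend b_word.
Definition connes_B : chain -> chain := extend B_word.
Definition b11 d phi : chain -> chain := extend (b11_word d phi).
Definition B11 d phi : chain -> chain := extend (B11_word d phi).
Definition gamma (x : chain) : chain := fun w => - (size w.2)%:R * x w.

(* The Koszul sign is that of the permutation taking                          *)
(* e_s, e^s, e_t, e^t, a_0, ..., a_i, b_0, ..., b_j to the order of the       *)
(* arguments in the product of the two factors c.                             *)
Definition mukai_word (w1 w2 : word) : R :=
  let: (a0, a) := w1 in let: (b0, b) := w2 in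
  \sum_(0 <= q < (size a).+1) \sum_(0 <= p < q.+1)
  \sum_(0 <= q' < (size b).+1) \sum_(0 <= p' < q'.+1)
  \sum_(s : I) \sum_(t : I) \sum_(x : I) \sum_(y : I)
    (-1) ^+ koszul [:: (6%N, wpar (drop q a)); (4%N, wpar (a0 :: take p a));
                       (0%N, par A s); (8%N, wpar (slice p' q' b));
                       (2%N, par A t);
                       (9%N, wpar (drop q' b)); (7%N, wpar (b0 :: take p' b));
                       (1%N, par A x); (5%N, wpar (slice p q a));
                       (3%N, par A y)]
    * (dual A s x * dual A t y)
    * cyc (drop q a ++ a0 :: take p a ++ s :: slice p' q' b) t
    * cyc (drop q' b ++ b0 :: take p' b ++ x :: slice p q a) y.

Definition mukai (x y : chain) : R :=
  \sum_(w \in [set: word * word]) x w.1 * y w.2 * mukai_word w.1 w.2.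

(* Coefficient of u^m of the higher residue pairing. *)
Definition hres (x y : lchain) (m : nat) : R :=
  \sum_(i < m.+1) (-1) ^+ i * mukai (x i%:Z) (y (m - i)%N%:Z).

Definition umul (x : lchain) : lchain := fun l => x (l - 1).
Definition b_uB (x : lchain) : lchain :=
  fun l w => hoch_b (x l) w + connes_B (x (l - 1)) w.

(* adic N r means that r belongs to the N-th power of the ideal defining the  *)
(* topology of R.                                                             *)
Variable adic : nat -> R -> Prop.

(* Elements of the inverse limit of the CC_*(A/m^N A). *)
Definition is_chain (x : chain) : Prop :=
  (forall w, ~~ reduced w -> x w = 0) /\
  (forall N, finite_set [set w | ~ adic N (x w)]).

Definition is_neg_chain (x : lchain) : Prop :=
  (forall l : int, l < 0 -> forall w, x l w = 0) /\ forall l, is_chain (x l).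

(* Elements of the inverse limit of the CC_*(A/m^N A)((u)). *)
Definition is_per_chain (x : lchain) : Prop :=
  (forall l, is_chain (x l)) /\
  (forall N, exists L : int, forall l, l < L -> forall w, adic N (x l w)).

Definition is_neg_cycle (x : lchain) : Prop :=
  is_neg_chain x /\ forall l w, b_uB x l w = 0.

Definition HCneg_eq (x y : lchain) : Prop :=
  exists2 z, is_neg_chain z & forall l w, x l w - y l w = b_uB z l w.

Definition HP_eq (x y : lchain) : Prop :=
  exists2 z, is_per_chain z & forall l w, x l w - y l w = b_uB z l w.

Definition is_HH_cycle (x : chain) : Prop :=
  is_chain x /\ forall w, hoch_b x w = 0.

Definition HH_eq (x y : chain) : Prop :=
  exists2 z, is_chain z & forall w, x w - y w = hoch_b z w.

(* The Hochschild differential [mu, psi] of psi of shifted parity d. *)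
Definition hoch_delta (d : bool) (psi : cochain) : cochain := fun l s =>
  let k := size l in
  \sum_(0 <= j < k.+1) \sum_(0 <= i < j.+1) \sum_(x : I)
    (-1) ^+ koszul [:: (1%N, wpar (take i l)); (0%N, d)]
    * psi (slice i j l) x * mu A (take i l ++ x :: drop j l) s
  - (-1) ^+ d * \sum_(0 <= j < k.+1) \sum_(0 <= i < j.+1) \sum_(x : I)
    (-1) ^+ koszul [:: (1%N, wpar (take i l)); (0%N, true)]
    * mu A (slice i j l) x * psi (take i l ++ x :: drop j l) s.

(* Equality in reduced Hochschild cohomology of the classes of two odd        *)
(* cocycles; like all reduced cochains they are compared on inputs without    *)
(* the unit, so mu itself stands for its part on such inputs.                 *)
Definition HHcoh_eq (phi phi' : cochain) : Prop :=
  exists psi : cochain,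
  [/\ forall l s, one A \in l -> psi l s = 0,
      forall l s, psi l s <> 0 -> par A s = wpar l &
      forall l s, one A \notin l -> phi l s - phi' l s = hoch_delta false psi l s].

End Hochschild.
Arguments is_chain {R A}.
Arguments is_neg_chain {R A}.
Arguments is_per_chain {R A}.

(* Basis indexed by bool: false is the unit and true is epsilon. The unit is  *)
(* strict, mu_2(1,a) = a = (-1)^|a| mu_2(a,1) with |a| the unshifted parity,  *)
(* and mu_k(epsilon, ..., epsilon) = c_k 1 is added to this. Cyclicity forces *)
(* <epsilon,1> = -1.                                                          *)
Definition superpotential_algebra (R : comNzRingType) (c : nat -> R) :
    ainf_data R :=
  {| idx := bool;
     par := negb;
     one := false;
     mu := fun l s =>
       (match l with
        | [:: false; a] => (s == a)%:R
        | [:: a; false] => (-1) ^+ a * (s == a)%:R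
        | _ => 0
        end) + (if all id l && ~~ s then c (size l) else 0);
     pairing := fun x y => if x == y then 0 else (-1) ^+ x;
     dual := fun s x => if x == s then 0 else (-1) ^+ s |}.

Fact superpotential_dualP (R : comNzRingType) (c : nat -> R) (A := superpotential_algebra c) :
  forall s t : bool, \sum_(x : bool) dual A t x * pairing A s x = (s == t)%:R.
Proof.
by case=> [] []; rewrite big_bool /= ?mulr0 ?mul0r ?addr0 ?add0r ?expr0
  ?expr1 ?mul1r ?mulr1 ?mulrNN ?mulr1.
Qed.

Section An.
Variables (K : fieldType) (n : nat).
Local Notation R := (mps n K).

Definition An : ainf_data K :=
  superpotential_algebra (fun k => if k == n.+1 then n.+1%:R^-1 else 0).

Definition versal_An : ainf_data R :=
  superpotential_algebra (fun k =>
    if insub k is Some j then mpsX K (j : 'I_n)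
    else if k == n.+1 then mpsC n n.+1%:R^-1 else 0).

(* Der(R) is free on the d/dt_j; v stands for \sum_j (v j) d/dt_j. *)
Definition vfield : Type := 'I_n -> R.
Definition vapply (v : vfield) (f : R) : R := \sum_(j < n) v j * mps_deriv j f.
Definition vmu (v : vfield) : cochain versal_An :=
  fun l s => vapply v (mu versal_An l s).

Definition kappa : cochain versal_An :=
  fun l s => (2%:R - (size l)%:R) * mu versal_An l s.

Definition nabla (v : vfield) (x : lchain versal_An) : lchain versal_An :=
  fun l w => vapply v (x l w) - b11 true (vmu v) (x (l + 1)) w
             - B11 true (vmu v) (x l) w.

Definition unabla (v : vfield) (x : lchain versal_An) : lchain versal_An :=
  umul (nabla v x).

Definition nabla_du (x : lchain versal_An) : lchain versal_An := fun l w =>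
  (l + 1)%:~R * x (l + 1) w
  + mpsC n 2^-1 * (gamma (x (l + 1)) w + B11 true kappa (x (l + 1)) w
                   + b11 true kappa (x (l + 2)) w).

Definition nabla_udu (x : lchain versal_An) : lchain versal_An :=
  umul (nabla_du x).

Definition at0 (x : lchain versal_An) : lchain An := fun l w => x l w 0%MM.

Definition omega : lchain An := fun l w =>
  if l is Posz l then
    (-1) ^+ l * (\prod_(j < l) (n + j * n.+1))%N%:R
    * (w == (true, nseq (n.-1 + n * l + l) true))%:R
  else 0.

Definition is_euler (E : vfield) : Prop := HHcoh_eq (vmu E) (mu versal_An).

Local Notation adicR := (@mps_adic n K).

Record is_categorical_primitive_form (zeta : lchain versal_An) : Prop := {
  cpf_cycle : is_neg_cycle adicR zeta;
  cpf_P0 : HCneg_eq (@discrete_adic K) (at0 zeta) omega;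
  cpf_P1 : forall x, is_HH_cycle adicR x ->
    exists! v : vfield, HH_eq adicR (unabla v zeta 0) x;
  cpf_P2 : forall v1 v2 m, (0 < m)%N ->
    hres (unabla v1 zeta) (unabla v2 zeta) m = 0;
  cpf_P3 : forall v1 v2 v3 m, (1 < m)%N ->
    hres (unabla v1 (unabla v2 zeta)) (unabla v3 zeta) m = 0;
  cpf_P4 : exists2 E, is_euler E & exists r : K,
    HP_eq adicR (fun l w => nabla_udu zeta l w + nabla E zeta l w)
                (fun l w => mpsC n r * zeta l w)
}.

(* Common to the categorical and the unfolding sides: H with u nabla_v, the
   pairing (its last argument is the exponent of u) and the primitive form z. *)
Section Potential.
Variables (H : Type) (un : vfield -> H -> H) (pair : H -> H -> nat -> R) (z : H).

Definition metric (v w : vfield) : R := pair (un v z) (un w z) 0.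

(* d i is the vector field d/dtau_i. *)
Definition is_coordinate_frame (tau : 'I_n -> R) (d : 'I_n -> vfield) : Prop :=
  forall i k, vapply (d i) (tau k) = (i == k)%:R.

Definition is_flat_coordinates (tau : 'I_n -> R) (d : 'I_n -> vfield) : Prop :=
  [/\ forall k, tau k 0%MM = 0,
      forall k j, tau k U_(j)%MM = - (k == j)%:R,
      is_coordinate_frame tau d &
      forall i j, exists c : K, metric (d i) (d j) = mpsC n c].

(* The potential is viewed as an element of K[[t]] = K[[tau]]. *)
Definition is_potential (d : 'I_n -> vfield) (F : R) : Prop :=
  forall i j k, vapply (d i) (vapply (d j) (vapply (d k) F))
                = pair (un (d i) (un (d j) z)) (un (d k) z) 0.

(* The insertion i is the class of u nabla_(d i) z at t = u = 0, which is
   [epsilon|epsilon^(n-1-i)] on the categorical side and x^i on the other. For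
   two insertions the correlator is the (constant) value of the flat metric. *)
Definition correlator (d : 'I_n -> vfield) (F : R) (s : seq 'I_n) : K :=
  if s is [:: i; j] then metric (d i) (d j) 0%MM
  else foldr (fun i => vapply (d i)) F s 0%MM.

End Potential.

(* The m-adic completion of R[x] is K[x][[t]]; forms g dx are written g.      *)
Local Notation Rx := (mps n {poly K}).

Definition unfolding : Rx :=
  mpsC n (n.+1%:R^-1 *: 'X^(n.+1)) + \sum_(j < n) mpsX _ j * mpsC n 'X^j.
Definition ddx (f : Rx) : Rx := mps_map (fun p => p^`()) f.
Definition toRx (f : R) : Rx := mps_map polyC f.

Definition useries : Type := nat -> Rx.
Definition usmul (g : useries) : useries := fun l => if l is l'.+1 then g l' else 0.

(* (u d - dF /\) h *)
Definition brieskorn_d (h : useries) : useries :=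
  fun l => usmul (fun l => ddx (h l)) l - ddx unfolding * h l.

Definition saito_unabla (v : vfield) (g : useries) : useries := fun l =>
  usmul (fun l => \sum_(j < n) toRx (v j) * mps_deriv j (g l)) l
  - (\sum_(j < n) toRx (v j) * mpsC n 'X^j) * g l.

(* u nabla_{u d/du} = u^2 d/du + F *)
Definition saito_unabla_udu (g : useries) : useries := fun l =>
  usmul (fun l => g l *+ l) l + unfolding * g l.

(* Res (g dx / F'), that is, the coefficient of x^-1 in the expansion at      *)
(* infinity g/F' = \sum_i g (-Q)^i x^(-n(i+1)), where F' = x^n + Q; as Q is   *)
(* in m, the terms with i > deg m do not contribute to the coefficient of t^m. *)
Definition residue (g : Rx) : R :=
  let Q := ddx unfolding - mpsC n 'X^n in
  Mps (fun m => \sum_(i < (mdeg m).+1) (((g * (- Q) ^+ i) m)`_(n * i.+1).-1)).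

(* K. Saito's characterization of the higher residue pairing. As the leading  *)
(* term is placed in degree 0, the pairing is u^-1 times one that is flat in  *)
(* the direction of u, hence the last term of shp_flat_u. The u-sesquilinear  *)
(* convention is that of hres.                                                *)
Record is_higher_residue_pairing (P : useries -> useries -> nat -> R) : Prop := {
  shp_addl : forall g g' h m, P (fun l => g l + g' l) h m = P g h m + P g' h m;
  shp_addr : forall g h h' m, P g (fun l => h l + h' l) m = P g h m + P g h' m;
  shp_scalel : forall a g h m, P (fun l => toRx a * g l) h m = a * P g h m;
  shp_scaler : forall a g h m, P g (fun l => toRx a * h l) m = a * P g h m;
  shp_ul : forall g h m,
    P (usmul g) h m = if m is m'.+1 then - P g h m' else 0;
  shp_ur : forall g h m,
    P g (usmul h) m = if m is m'.+1 then P g h m' else 0;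
  shp_exactl : forall g h m, P (brieskorn_d g) h m = 0;
  shp_exactr : forall g h m, P g (brieskorn_d h) m = 0;
  shp_sym : forall g h m, P g h m = (-1) ^+ m * P h g m;
  shp_flat_t : forall v g h m,
    (if m is m'.+1 then vapply v (P g h m') else 0)
    = - P (saito_unabla v g) h m + P g (saito_unabla v h) m;
  shp_flat_u : forall g h m,
    (if m is m'.+1 then P g h m' *+ m' else 0)
    = - P (saito_unabla_udu g) h m + P g (saito_unabla_udu h) m
      - (if m is m'.+1 then P g h m' else 0);
  shp_leading : forall g h, P g h 0 = residue (g 0%N * h 0%N)
}.

Definition saito_dx : useries := fun l => if l is 0 then 1 else 0.

End An.

(* Main.v *)
Require Import Defs.
From mathcomp Require Import all_boot all_order all_algebra.
From mathcomp Require Import boolp classical_sets functions cardinality.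
From mathcomp Require Import fsbigop mpoly ring zify.
Set Implicit Arguments.
Unset Strict Implicit.
Unset Printing Implicit Defensive.
Import GRing.Theory.
Local Open Scope ring_scope.

(** Let F = sum_k c_k x^k be the unfolding, so that c_k is the structure constant
    of mu_k on the word epsilon^k, and write e_k = epsilon|epsilon^k and
    o_k = 1|epsilon^k. The e_k and the o_k are all the reduced words. Reading e_k
    and o_k as x^(-k-1) modulo polynomials in x, the Hochschild differential sends
    e to o by multiplication by F', the Connes operator is -d/dx, and both kill o
    ([hoch_b_eps], [connes_B_eps]). As nothing is mapped to e, two cohomologous
    negative or periodic cyclic chains have equal e-components, so the conditions
    on zeta become identities between power series. Similarly b^{1|1}(v(mu)) is
    multiplication by v(F) ([b11_eps]), and the Mukai pairing of f and g in e is
    the residue of f g F' ([mukai_eps]).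

    Let z be the e-component of zeta at u = 0. The class E of mu is the Euler field,
    with t_k of weight 1 - k/(n+1), because F - E(F) is the multiple x F'/(n+1) of
    F' ([euler_coef]). With this, the homogeneity of zeta says that the coefficient z_k of e_k
    is E-homogeneous, of weight (k+1-n)/(n+1) once r has been read off from the value
    omega of zeta at t = 0. The weights of the t_j are positive, so z_k is constant
    for k < n, and omega gives z_0 = ... = z_(n-2) = 0 and z_(n-1) = 1. As z is killed
    by F', it is the expansion of 1/F' at infinity ([primitive_form_recip]). Hence
    the metric and the three-point tensor of zeta on Der(R) are, up to sign, the
    residues of v(F) w(F)/F' and v1(F) v2(F) v3(F)/F'.

    For dx the same tensors are the leading terms of K. Saito's pairing, given by the
    residue of the same forms; the residues of x^k dx/F' are again the coefficients
    of 1/F' at infinity ([residue_recip]), so the tensors of the two sides coincide.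
    Finally, flat coordinates with a prescribed linear part are unique
    ([flat_frame_unique]): the Jacobian matrix between two flat frames is constant,
    by the argument that gives the uniqueness of the Levi-Civita connection. All the
    correlators are then computed from the same data in the same frame. *)

(** * Reduced words of a superpotential algebra *)

Definition eps (k : nat) : seq bool := nseq k true.

Lemma reduced_eps (R : comNzRingType) (c : nat -> R)
    (w : word (superpotential_algebra c)) :
  reduced w -> w = (w.1, eps (size w.2)).
Proof.
case: w => a l; rewrite /reduced /= => redl; congr (_, _).
by elim: l redl => //= -[] l IHl //; rewrite inE /= => /IHl {1}->.
Qed.

Lemma reduced_epsE (R : comNzRingType) (c : nat -> R) (a : bool) k :
  @reduced R (superpotential_algebra c) (a, eps k).
Proof. by rewrite /reduced /= mem_nseq andbF. Qed.

Lemma take_eps i k : take i (eps k) = eps (minn i k).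
Proof. by rewrite /eps; elim: k i => [|k IHk] [|i] //=; rewrite IHk minnSS. Qed.

Lemma drop_eps i k : drop i (eps k) = eps (k - i).
Proof. by rewrite /eps; elim: k i => [|k IHk] [|i] //=; rewrite IHk subSS. Qed.

Lemma slice_eps i j k : slice i j (eps k) = eps (minn (j - i) (k - i)).
Proof. by rewrite /slice drop_eps take_eps. Qed.

Lemma cat_eps i j : eps i ++ eps j = eps (i + j).
Proof. by rewrite /eps nseqD. Qed.

Lemma cat_eps1 i j : eps i ++ true :: eps j = eps (i + j).+1.
Proof. by rewrite (cat_eps i j.+1) addnS. Qed.

Lemma cons_eps i : true :: eps i = eps i.+1.
Proof. by []. Qed.

Lemma eps_inj i j : (eps i == eps j) = (i == j).
Proof.
by apply/eqP/eqP => [e|->//]; rewrite -(size_nseq i true) -(size_nseq j true) -/(eps i) e.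
Qed.

Definition words (M : nat) : seq (bool * seq bool) :=
  [seq (a, eps (k : 'I_M)) | a <- [:: true; false], k <- index_enum 'I_M].

Lemma words_uniq M : uniq (words M).
Proof.
apply: allpairs_uniq => //; first exact: index_enum_uniq.
move=> [a i] [b j] _ _ [-> /eqP]; rewrite eps_inj => /eqP ij.
by congr (_, _); apply: val_inj.
Qed.

Lemma mem_words (R : comNzRingType) (c : nat -> R) M
    (w : word (superpotential_algebra c)) :
  reduced w -> (size w.2 < M)%N -> (w : bool * seq bool) \in words M.
Proof.
move=> redw szw; rewrite (reduced_eps redw).
apply/allpairsP; exists (w.1, Ordinal szw); split=> //=.
  by case: (w.1).
exact: mem_index_enum.
Qed.

Lemma big_words (V : nmodType) M (f : bool * seq bool -> V) :
  \sum_(w <- words M) f w = \sum_(k < M) (f (true, eps k) + f (false, eps k)).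
Proof.
rewrite /words /= big_cat /= big_cat /= big_nil /= !big_map /=.
by rewrite addr0 -big_split.
Qed.

(** The operators on chains are sums of finite support over all the words; this
    turns them into sums over an interval. *)
Lemma sum_words (R : comNzRingType) (c : nat -> R) (A := superpotential_algebra c)
    (M : nat) (f : word A -> R) :
  (forall w, f w != 0 -> reduced w && (size w.2 < M)%N) ->
  \sum_(w \in [set: word A]) f w
  = \sum_(k < M) (f (true, eps k) + f (false, eps k)).
Proof.
move=> supp; pose r : seq (word A) := words M.
have ur : uniq r by exact: words_uniq.
rewrite -big_words (fsbigE r f ur) //.
  by under eq_bigl do rewrite in_setT.
move=> w _ /negP wr; apply/eqP/negPn/negP => /supp/andP[redw szw].
by apply: wr; apply: mem_words.
Qed.

Lemma sum_word_pairs (R : comNzRingType) (c : nat -> R)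
    (A := superpotential_algebra c) (M : nat) (f : word A * word A -> R) :
  (forall w, f w != 0 -> [&& reduced w.1, (size w.1.2 < M)%N,
                           reduced w.2 & (size w.2.2 < M)%N]) ->
  \sum_(w \in [set: word A * word A]) f w
  = \sum_(w1 <- words M) \sum_(w2 <- words M) f (w1, w2).
Proof.
move=> supp.
pose r : seq (word A * word A) := [seq (w1, w2) | w1 <- words M, w2 <- words M].
have ur : uniq r.
  by apply: allpairs_uniq; [exact: words_uniq | exact: words_uniq | move=> [? ?] [? ?]].
rewrite (fsbigE r f ur) //.
  under eq_bigl do rewrite in_setT.
  by rewrite /r big_allpairs.
move=> w _ /negP wr; apply/eqP/negPn/negP => /supp/and4P[red1 sz1 red2 sz2].
by apply: wr; apply/allpairsP; exists w; split;
  [exact: (mem_words (c := c)) | exact: (mem_words (c := c)) | case: (w)].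
Qed.
(** * Operators on words *)

Section SuperpotentialChains.
Variables (R : comNzRingType) (c : nat -> R).
Local Notation A := (superpotential_algebra c).
Implicit Types (x : chain A) (w : word A).

Lemma wpar_eps k : wpar (A := A) (eps k) = false.
Proof. by rewrite /wpar; elim: k. Qed.

Lemma mu_eps k (s : bool) : mu A (eps k) s = if s then 0 else c k.
Proof.
have all_eps : all id (eps k) by elim: k.
rewrite /= all_eps; case: k all_eps => [|[|[|k]]] _ /=; case: s;
  by rewrite /= ?addr0 ?add0r ?size_nseq.
Qed.

Lemma mu_1unit i j (s : bool) : mu A (eps i ++ false :: eps j) s
  = if s then ((i == 0) && (j == 1))%N%:R - ((i == 1) && (j == 0))%N%:R else 0.
Proof.
have -> : mu A (eps i ++ false :: eps j) s =
    match eps i ++ false :: eps j with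
        | [:: false; a] => (s == a)%:R
        | [:: a; false] => (-1) ^+ a * (s == a)%:R
        | _ => 0
        end :> R.
  by rewrite /= all_cat /= andbF addr0.
case: i => [|[|[|i]]]; case: j => [|[|j]] //=; case: s; 
  rewrite /= ?eqxx ?mulr1 ?mulr0 ?subr0 ?sub0r ?expr1 //.
Qed.

Lemma mu_2unit i l (s : bool) :
  (2 < size (eps i ++ false :: l))%N -> mu A (eps i ++ false :: l) s = 0.
Proof.
have -> : mu A (eps i ++ false :: l) s =
    match eps i ++ false :: l with
        | [:: false; a] => (s == a)%:R
        | [:: a; false] => (-1) ^+ a * (s == a)%:R
        | _ => 0
        end :> R.
  by rewrite /= all_cat /= andbF addr0.
by case: i => [|[|[|i]]]; case: l => [|[] [|b l]].
Qed.

Lemma mu_units_eps i j l :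
  mu A (eps i ++ false :: eps j ++ false :: l) true = 0.
Proof.
have [short|/mu_2unit->//] := leqP (size (eps i ++ false :: eps j ++ false :: l)) 2.
move: short; rewrite size_cat /= size_cat /= !size_nseq => short.
have -> : i = 0%N by lia.
have -> : j = 0%N by lia.
have -> : l = [::] by apply: size0nil; lia.
by rewrite /= addr0.
Qed.

Lemma eps_unit_eq i l k : (eps i ++ false :: l == eps k) = false.
Proof.
apply/negP => /eqP e; have : false \in eps k by rewrite -e mem_cat inE orbT.
by rewrite mem_nseq andbF.
Qed.

Lemma extend_eps (M : nat) (op : word A -> word A -> R) x w' :
  reduced w' -> (forall w, ~~ reduced w -> x w = 0) ->
  (forall a k, (M <= k)%N -> op (a, eps k) w' = 0) ->
  extend op x w' = \sum_(k < M) (x (true, eps k) * op (true, eps k) w'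
                               + x (false, eps k) * op (false, eps k) w').
Proof.
move=> redw' xred opM; rewrite /extend redw' (sum_words (M := M)) // => w nz.
have redw : reduced w.
  by apply: contraR nz => /xred ->; rewrite mul0r.
rewrite redw /= ltnNge; apply: contra nz => szw.
by rewrite (reduced_eps redw) opM ?mulr0.
Qed.

(** The number of ways to place an interval of length a among k letters is
    k + 1 - a; this is where the coefficients k c_k of F' come from. *)
Lemma triangle_sum (f : nat -> R) k :
  \sum_(0 <= p < k.+1) \sum_(0 <= j < p.+1) f (p - j)%N
  = \sum_(a < k.+1) f a *+ (k.+1 - a).
Proof.
elim: k => [|k IHk].
  by rewrite !big_nat1 big_ord_recl big_ord0 addr0.
rewrite big_nat_recr //= IHk [RHS]big_ord_recr /= subSnn mulr1n.
have -> : \sum_(0 <= j < k.+2) f (k.+1 - j)%N = \sum_(a < k.+1) f a + f k.+1.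
  rewrite big_nat_rev big_mkord big_ord_recr /= add0n subSS subnn subn0.
  congr (_ + _); apply: eq_bigr => a _; congr (f _); have := ltn_ord a; lia.
rewrite addrA -big_split; congr (_ + _); apply: eq_bigr => a _ /=.
by rewrite (subSn (ltnW (ltn_ord a))) mulrSr.
Qed.

#[local] Arguments mu : simpl never.
#[local] Arguments slice : simpl never.
#[local] Arguments koszul : simpl never.
#[local] Arguments eps : simpl never.

Lemma sum_idx (f : bool -> R) : \sum_(s : idx A) f s = f true + f false.
Proof. exact: big_bool. Qed.

Lemma koszul_swap_even b : koszul [:: (1%N, false); (0%N, b)] = false.
Proof. by case: b. Qed.

(** The only terms that produce e are mu_2(1, epsilon) and mu_2(epsilon, 1) applied
    at the two ends of a cyclic word; their signs are opposite. *)
Lemma b_word_to_eps (a : bool) k m : b_word (A := A) (a, eps k) (true, eps m) = 0.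
Proof.
rewrite /b_word size_nseq; case: a.
  rewrite !big1 ?addr0 // => p _; rewrite big1 // => j _; rewrite big_bool /=.
    by rewrite !drop_eps !take_eps cat_eps1 !mu_eps !mulr0 mul0r addr0.
  rewrite !slice_eps !mu_eps mulr0 mul0r add0r.
  by rewrite xpair_eqE /= take_eps [_ == _ ++ _]eq_sym eps_unit_eq mulr0.
rewrite [X in X + _]big1 ?add0r; last first.
  move=> p _; rewrite big1 // => j _; rewrite big1 // => s _.
  by rewrite xpair_eqE mulr0.
pose f p j : R := ((k - p == 0) && (j == 1))%N%:R - ((k - p == 1) && (j == 0))%N%:R.
transitivity ((m == k.-1)%:R * \sum_(0 <= p < k.+1) \sum_(0 <= j < p.+1) f p j).
  rewrite mulr_sumr; apply: eq_big_nat => p /andP[_ pk].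
  rewrite mulr_sumr; apply: eq_big_nat => j /andP[_ jp].
  rewrite big_bool /= !drop_eps !take_eps /= !mu_1unit xpair_eqE /= mulr0.
  rewrite addr0 slice_eps eps_inj wpar_eps koszul_swap_even expr0 mul1r mulrC.
  have [e|] := boolP ((k - p == 0) && (j == 1))%N.
    move/andP: (e) => [/eqP kp /eqP j1]; have -> : minn j k = 1%N by lia.
    have -> : minn (p - j) (k - j) = k.-1 by lia.
    by rewrite /f e kp.
  have [e _|] := boolP ((k - p == 1) && (j == 0))%N.
    move/andP: (e) => [/eqP kp /eqP j1]; have -> : minn j k = 0%N by lia.
    have -> : minn (p - j) (k - j) = k.-1 by lia.
    by rewrite /f e kp j1.
  move=> n1 n2; rewrite /f (negbTE n1) (negbTE n2).
  have -> : minn j k = j by lia.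
  by rewrite (negbTE n1) (negbTE n2) subrr !mulr0.
rewrite {}/f; case: k => [|k].
  by rewrite !big_nat1 subrr mulr0.
rewrite big_nat_recr // big_nat_recr //= [X in X + _ + _]big_nat big1 ?add0r.
  rewrite [X in _ * (_ + X)]big_nat_recl // [X in _ + (_ + X)]big_nat_recl //.
  rewrite [X in _ * (X + _)]big_nat_recl // ![\sum_(0 <= i < k) _]big1.
  - by rewrite subnn subSnn /=; ring.
  - by move=> i _; rewrite subnn subrr.
  - by move=> i _; rewrite subSnn andbF subrr.
move=> p /andP[_ pk]; apply: big1 => j _.
have -> : (k.+1 - p == 0)%N = false by lia.
have -> : (k.+1 - p == 1)%N = false by lia.
by rewrite subrr.
Qed.

(** Only the products mu_j that contain the first letter survive: the others insert
    a unit in a slot where it is killed. *)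
Lemma b_word_eps k m : b_word (A := A) (true, eps k) (false, eps m)
  = if (m <= k)%N then c (k - m).+1 *+ (k - m).+1 else 0.
Proof.
rewrite /b_word size_nseq [X in X + _]big1 ?add0r; last first.
  by move=> p _; rewrite big1 // => j _; rewrite big1 // => s _; rewrite mulr0.
pose f a := c (k - a).+1 *+ (a == m).
transitivity (\sum_(0 <= p < k.+1) \sum_(0 <= j < p.+1) f (p - j)%N).
  apply: eq_big_nat => p /andP[_ pk]; apply: eq_big_nat => j /andP[_ jp].
  rewrite sum_idx !drop_eps !take_eps !cat_eps1 !mu_eps !(mulr0, mul0r, add0r).
  rewrite slice_eps wpar_eps koszul_swap_even expr0 mul1r xpair_eqE /= eps_inj.
  rewrite /f mulr_natr; congr (c _ *+ nat_of_bool _); [lia | ].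
  by rewrite eq_sym; congr (_ == _); lia.
rewrite triangle_sum /f; have [mk|km] := leqP m k.
  rewrite (bigD1 (Ordinal (mk : (m < k.+1)%N))) //= eqxx mulr1n subSn //.
  rewrite big1 ?addr0 // => a; rewrite -val_eqE /= => /negbTE ->.
  by rewrite mulr0n mul0rn.
rewrite big1 // => a _; have /ltn_eqF -> : (a < m)%N by have := ltn_ord a; lia.
by rewrite mulr0n mul0rn.
Qed.

Lemma b_word_1eps k m : b_word (A := A) (false, eps k) (false, eps m) = 0.
Proof.
rewrite /b_word size_nseq !big1 ?addr0 // => p _; rewrite big1 // => j _.
  by rewrite sum_idx !drop_eps !take_eps !mu_1unit !(mulr0, mul0r, addr0).
rewrite sum_idx !slice_eps !drop_eps !take_eps !mu_eps !(mulr0, mul0r, add0r).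
by rewrite xpair_eqE /= [_ == _ ++ _]eq_sym eps_unit_eq mulr0.
Qed.

Lemma B_word_to_eps w k : B_word (A := A) w (true, eps k) = 0.
Proof. by case: w => a l; rewrite /B_word big1 // => p _; rewrite mulr0. Qed.

Lemma B_word_eps k m :
  B_word (A := A) (true, eps k) (false, eps m) = ((m == k.+1)%:R *+ m).
Proof.
rewrite /B_word size_nseq.
transitivity (\sum_(0 <= p < k.+1) ((m == k.+1)%:R : R)).
  apply: eq_big_nat => p /andP[_ pk].
  rewrite !drop_eps !take_eps !cat_eps1 wpar_eps koszul_swap_even mul1r.
  by rewrite xpair_eqE eqxx eps_inj; congr ((_ == _)%:R); lia.
rewrite big_mkord sumr_const card_ord.
by case: eqP => [->|_]; rewrite ?mul0rn.
Qed.

Lemma B_word_1eps k m : B_word (A := A) (false, eps k) (false, eps m) = 0.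
Proof.
rewrite /B_word big1 // => p _; rewrite !drop_eps !take_eps xpair_eqE.
by rewrite [_ == _ ++ _]eq_sym eps_unit_eq mulr0.
Qed.

Lemma B11_word_to_eps d phi w k : B11_word (A := A) d phi w (true, eps k) = 0.
Proof.
case: w => a l; rewrite /B11_word !big1 // => r _; rewrite big1 // => q _.
by rewrite big1 // => p _; rewrite big1 // => s _; rewrite mulr0.
Qed.

Lemma b11_word_1eps d (phi : cochain A) k m :
  (forall i, phi (eps i) true = 0) ->
  b11_word d phi (false, eps k) (true, eps m) = 0.
Proof.
move=> phi1; rewrite /b11_word big1 // => r _; rewrite big1 // => q _.
rewrite big1 // => p _; rewrite big1 // => j _.
rewrite sum_idx [X in X + _]big1 ?add0r; last first.
  by move=> s _; rewrite !slice_eps phi1 mulr0 !mul0r.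
rewrite sum_idx !slice_eps !drop_eps !take_eps mu_units_eps.
by rewrite xpair_eqE /= !(mulr0, mul0r, addr0).
Qed.

(** The value of phi is a multiple of the unit, and mu of a word containing the unit
    and the first letter epsilon vanishes unless it is mu_2(1, epsilon). *)
Lemma b11_word_eps d (phi : cochain A) k m :
  (forall i, phi (eps i) true = 0) ->
  b11_word d phi (true, eps k) (true, eps m)
  = if (m <= k)%N then phi (eps (k - m)) false else 0.
Proof.
move=> phi1; rewrite /b11_word size_nseq.
pose f (r q p j : nat) : R :=
  if [&& r == k, q == p & j == 0%N] then phi (eps (k - p)) false *+ (p == m) else 0.
transitivity (\sum_(0 <= r < k.+1) \sum_(0 <= q < r.+1) \sum_(0 <= p < q.+1)
   \sum_(0 <= j < p.+1) f r q p j).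
  apply: eq_big_nat => r /andP[_ rk]; apply: eq_big_nat => q /andP[_ qr].
  apply: eq_big_nat => p /andP[_ pq]; apply: eq_big_nat => j /andP[_ jp].
  rewrite sum_idx [X in X + _]big1 ?add0r; last first.
    by move=> s _; rewrite !slice_eps phi1 mulr0 !mul0r.
  rewrite sum_idx !slice_eps !drop_eps !take_eps !wpar_eps cat_eps1 !mu_1unit.
  rewrite andbF subr0 !(mulr0, mul0r, addr0) xpair_eqE eqxx eps_inj cons_eps wpar_eps /f.
  have -> : koszul [:: (2%N, false); (0%N, d); (3%N, false); (1%N, false)] = false.
    by case: d.
  rewrite expr0 mul1r andTb.
  case: (boolP [&& _, _ & _]) => [/and3P[/eqP rk' /eqP qp /eqP j0]|nz].
    have -> : minn (q - p) (k - p) = 0%N by lia.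
    have -> : (k - r + minn j k).+1 = 1%N by lia.
    rewrite mulr1 mulr_natr rk' qp eq_sym minnn.
    by have -> : minn (p - j) (k - j) = p by lia.
  have -> : (minn (q - p) (k - p) == 0)%N && ((k - r + minn j k).+1 == 1)%N = false.
    apply: contraNF nz; lia.
  by rewrite mulr0 mul0r.
rewrite big_nat_recr //= big_nat [X in X + _]big1 ?add0r; last first.
  move=> r /andP[_ rk]; rewrite !big1 // => q _; rewrite big1 // => p _.
  by rewrite big1 // => j _; rewrite /f (ltn_eqF rk).
transitivity (\sum_(0 <= q < k.+1) phi (eps (k - q)) false *+ (q == m)).
  apply: eq_big_nat => q _; rewrite big_nat_recr //= big_nat [X in X + _]big1.
    by rewrite add0r big_nat_recl // big1 ?addr0 /f ?eqxx.
  by move=> p /andP[_ pq]; rewrite big1 // => j _; rewrite /f (gtn_eqF pq) andbF.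
rewrite big_mkord; have [mk|km] := leqP m k.
  rewrite (bigD1 (Ordinal (mk : (m < k.+1)%N))) //= eqxx mulr1n.
  by rewrite big1 ?addr0 // => a; rewrite -val_eqE /= => /negbTE ->.
by rewrite big1 // => a _; have /ltn_eqF -> : (a < m)%N by have := ltn_ord a; lia.
Qed.

(** * Operators on chains *)

Lemma extend_eq0 (op : word A -> word A -> R) x w' :
  (forall w, ~~ reduced w -> x w = 0) ->
  (forall w, reduced w -> op w w' = 0) -> extend op x w' = 0.
Proof.
move=> xred op0; rewrite /extend; case: ifP => // _; rewrite fsbig1 // => w _.
by have [/op0 ->|/xred ->] := boolP (reduced w); rewrite ?mulr0 ?mul0r.
Qed.

Lemma hoch_b_to_eps x k :
  (forall w, ~~ reduced w -> x w = 0) -> hoch_b x (true, eps k) = 0.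
Proof.
by move=> xred; apply: extend_eq0 => // w /reduced_eps ->; apply: b_word_to_eps.
Qed.

Lemma connes_B_to_eps x k :
  (forall w, ~~ reduced w -> x w = 0) -> connes_B x (true, eps k) = 0.
Proof. by move=> xred; apply: extend_eq0 => // w _; apply: B_word_to_eps. Qed.

Lemma B11_to_eps d phi x k :
  (forall w, ~~ reduced w -> x w = 0) -> B11 d phi x (true, eps k) = 0.
Proof. by move=> xred; apply: extend_eq0 => // w _; apply: B11_word_to_eps. Qed.

Lemma connes_B_eps x m : (forall w, ~~ reduced w -> x w = 0) ->
  connes_B x (false, eps m) = x (true, eps m.-1) *+ m.
Proof.
move=> xred; rewrite /connes_B (@extend_eps m) ?reduced_epsE //; last first.
  move=> [] k mk; last exact: B_word_1eps.
  by rewrite B_word_eps ltn_eqF ?mul0rn.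
under eq_bigr do rewrite B_word_eps B_word_1eps mulr0 addr0.
case: m => [|m]; first by rewrite big_ord0.
rewrite big_ord_recr /= eqxx mulr_natr big1 ?add0r // => i _.
by rewrite eqSS gtn_eqF // mul0rn mulr0.
Qed.

Section Contraction.
Variables (N : nat) (x : chain A).
Hypothesis xred : forall w, ~~ reduced w -> x w = 0.

Lemma contraction_sum (f : nat -> R) m :
  \sum_(k < m + N) x (true, eps k) * (if (m <= k)%N then f (k - m)%N else 0)
  = \sum_(j < N) f j * x (true, eps (m + j)).
Proof.
rewrite big_split_ord /= big1 ?add0r; last first.
  by move=> i _; rewrite leqNgt ltn_ord mulr0.
by apply: eq_bigr => j _; rewrite leq_addr mulrC addKn.
Qed.

Lemma hoch_b_eps m : (forall k, (N < k)%N -> c k = 0) ->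
  hoch_b x (false, eps m) = \sum_(j < N) (c j.+1 *+ j.+1) * x (true, eps (m + j)).
Proof.
move=> cN; rewrite /hoch_b (@extend_eps (m + N)) ?reduced_epsE //; last first.
  move=> [] k mk; last exact: b_word_1eps.
  by rewrite b_word_eps; case: leqP => // _; rewrite cN ?mul0rn //; lia.
under eq_bigr do rewrite b_word_eps b_word_1eps mulr0 addr0.
exact: contraction_sum (fun j => c j.+1 *+ j.+1) m.
Qed.

Lemma b11_eps d (phi : cochain A) m :
  (forall i, phi (eps i) true = 0) ->
  (forall i, (N <= i)%N -> phi (eps i) false = 0) ->
  b11 d phi x (true, eps m) = \sum_(i < N) phi (eps i) false * x (true, eps (m + i)).
Proof.
move=> phi1 phiN; rewrite /b11 (@extend_eps (m + N)) ?reduced_epsE //; last first.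
  move=> [] k mk; last exact: b11_word_1eps.
  by rewrite b11_word_eps //; case: leqP => // _; rewrite phiN //; lia.
under eq_bigr do rewrite b11_word_eps // b11_word_1eps // mulr0 addr0.
exact: contraction_sum (fun i => phi (eps i) false) m.
Qed.

End Contraction.

Lemma cycE l (z : bool) : cyc (A := A) l z = if z then mu A l false else - mu A l true.
Proof. by rewrite /cyc sum_idx; case: z; rewrite /= ?expr1 ?expr0; ring. Qed.

Lemma mu_units_to_unit i j k :
  mu A (eps i ++ false :: eps j ++ false :: eps k) false
  = [&& i == 0, j == 0 & k == 0]%N%:R.
Proof.
have [short|long] := leqP (size (eps i ++ false :: eps j ++ false :: eps k)) 2.
  move: short; rewrite !(size_cat, size_nseq) /= !(size_cat, size_nseq) /= size_nseq => short.
  have [-> -> ->] : [/\ i = 0, j = 0 & k = 0]%N by split; lia.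
  by rewrite /mu /= addr0.
rewrite mu_2unit //; move: long.
rewrite !(size_cat, size_nseq) /= !(size_cat, size_nseq) /= size_nseq.
by case: i j k => [|i] [|j] [|k].
Qed.

Lemma sum_dual (G : bool -> bool -> bool -> bool -> R) :
  (forall s t y : bool, G s t s y = 0) -> (forall s t z : bool, G s t z t = 0) ->
  \sum_(s : idx A) \sum_(t : idx A) \sum_(z : idx A) \sum_(y : idx A) G s t z y
  = G true true false false + G true false false true
    + (G false true true false + G false false true true).
Proof.
by move=> G1 G2; rewrite !sum_idx !(G1, G2) !(add0r, addr0).
Qed.

#[local] Arguments wpar : simpl never.
#[local] Arguments cyc : simpl never.

Lemma wpar_1eps k : wpar (A := A) (false :: eps k) = true.
Proof. by rewrite /wpar /=; have := wpar_eps k; rewrite /wpar => ->. Qed.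

Lemma cat_eps1l i j l : eps i ++ true :: eps j ++ l = eps (i + j).+1 ++ l.
Proof. by rewrite -cat_cons catA cat_eps1. Qed.

Let cat_epsE := (cat_eps1, cat_eps1l).
Let muE := (mu_units_eps, mu_units_to_unit, mu_eps, mu_1unit).

(** The two factors c are both non-zero only for the pairing of 1 with itself, and
    there the contributions of (s, t) = (epsilon, 1) and (1, epsilon) cancel by their
    Koszul signs. *)
Lemma mukai_word_1eps b0 i j : mukai_word (A := A) (false, eps i) (b0, eps j) = 0.
Proof.
rewrite /mukai_word size_nseq big1 // => q _; rewrite big1 // => p _.
rewrite big1 // => q' _; rewrite big1 // => p' _.
rewrite sum_dual; last first.
- by move=> s t y; rewrite /= eqxx !(mulr0, mul0r).
- by move=> s t y; rewrite /= eqxx !(mulr0, mul0r).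
rewrite !drop_eps !take_eps !slice_eps !wpar_eps wpar_1eps !cycE.
case: b0; rewrite !cat_epsE ?muE.
  by rewrite !(oppr0, mulr0, mul0r, addr0).
rewrite wpar_1eps !(oppr0, mulr0, mul0r, addr0, add0r) /koszul /=.
rewrite !andbF !subr0 !eqSS !addn_eq0.
by ring.
Qed.

Lemma mukai_word_eps_1eps i j : mukai_word (A := A) (true, eps i) (false, eps j) = 0.
Proof.
rewrite /mukai_word size_nseq big1 // => q _; rewrite big1 // => p _.
rewrite big1 // => q' _; rewrite big1 // => p' _.
rewrite sum_dual; last first.
- by move=> s t y; rewrite /= eqxx !(mulr0, mul0r).
- by move=> s t y; rewrite /= eqxx !(mulr0, mul0r).
rewrite !drop_eps !take_eps !slice_eps !wpar_eps wpar_1eps !cycE.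
by rewrite !cat_epsE ?muE !(oppr0, mulr0, mul0r, addr0).
Qed.

(** One of the two factors is the pairing of mu_2(epsilon, 1) with 1 and contains a
    single letter, the first one of one of the two chains; the other factor is
    c_(i+j+2), for each of the i + 1, respectively j + 1, rotations of the other
    chain. *)
Lemma mukai_word_eps i j :
  mukai_word (A := A) (true, eps i) (true, eps j) = c (i + j).+2 *+ (i + j).+2.
Proof.
rewrite /mukai_word !size_nseq.
pose f a b : R := c (i - a + b).+2 *+ ((b == j) && (a == 0))
                + c (j - b + a).+2 *+ ((a == i) && (b == 0)).
transitivity (\sum_(0 <= q < i.+1) \sum_(0 <= p < q.+1) \sum_(0 <= q' < j.+1)
   \sum_(0 <= p' < q'.+1) f (q - p)%N (q' - p')%N).
  apply: eq_big_nat => q /andP[_ qi]; apply: eq_big_nat => p /andP[_ pq].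
  apply: eq_big_nat => q' /andP[_ qj]; apply: eq_big_nat => p' /andP[_ pq'].
  rewrite sum_dual; last first.
  - by move=> s t y; rewrite /= eqxx !(mulr0, mul0r).
  - by move=> s t y; rewrite /= eqxx !(mulr0, mul0r).
  (* The summands left are s = t = epsilon and s = t = 1. *)
  rewrite !drop_eps !take_eps !slice_eps !wpar_eps !cycE !cat_epsE ?muE.
  rewrite !cons_eps !wpar_eps !(oppr0, mulr0, mul0r, addr0, add0r) /koszul /=.
  have -> : minn p i = p by lia.
  have -> : minn p' j = p' by lia.
  have -> : minn (q' - p') (j - p') = (q' - p')%N by lia.
  have -> : minn (q - p) (i - p) = (q - p)%N by lia.
  rewrite /f -[in RHS]mulr_natr -[in X in _ = _ + X]mulr_natr.
  have -> : ((j - q' + p').+1 == 1)%N = (q' - p' == j)%N by lia.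
  have -> : ((i - q + p).+1 == 1)%N = (q - p == i)%N by lia.
  have -> : ((i - q + p).+1 + (q' - p')).+1 = (i - (q - p) + (q' - p')).+2 by lia.
  have -> : ((j - q' + p').+1 + (q - p)).+1 = (j - (q' - p') + (q - p)).+2 by lia.
  by ring.
have -> : \sum_(0 <= q < i.+1) \sum_(0 <= p < q.+1) \sum_(0 <= q' < j.+1)
    \sum_(0 <= p' < q'.+1) f (q - p)%N (q' - p')%N
  = \sum_(a < i.+1) (\sum_(b < j.+1) f a b *+ (j.+1 - b)) *+ (i.+1 - a).
  rewrite -(triangle_sum (fun a => \sum_(b < j.+1) f a b *+ (j.+1 - b))).
  by do 2!apply: eq_bigr => ? _; rewrite triangle_sum.
transitivity (c (i + j).+2 *+ i.+1 + c (i + j).+2 *+ j.+1); last first.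
  by rewrite -mulrnDr addSn addnS.
have sum_delta k (a : 'I_k) (g : nat -> R) : \sum_(b < k) g b *+ (b == a :> nat) = g a.
  rewrite (bigD1 a) //= eqxx big1 ?addr0 // => b; rewrite -val_eqE /= => /negbTE ->.
  by rewrite mulr0n.
pose g1 a := c (i - a + j).+2 *+ (i.+1 - a).
pose g2 a := c (j + a).+2 *+ (j.+1 * (i.+1 - a)).
transitivity (\sum_(a < i.+1) (g1 a *+ (a == @ord0 i :> nat)
                                + g2 a *+ (a == @ord_max i :> nat))).
  apply: eq_bigr => a _.
  have -> : \sum_(b < j.+1) f a b *+ (j.+1 - b)
    = \sum_(b < j.+1) (c (i - a + b).+2 *+ (a == @ord0 i :> nat) *+ (j.+1 - b))
                       *+ (b == @ord_max j :> nat)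
    + \sum_(b < j.+1) (c (j - b + a).+2 *+ (a == @ord_max i :> nat) *+ (j.+1 - b))
                       *+ (b == @ord0 j :> nat).
    rewrite -big_split; apply: eq_bigr => b _ /=.
    by rewrite /f mulrnDl -!mulrnA; congr (_ *+ _ + _ *+ _);
      do 2![case: eqP => _]; rewrite /= ?(mul1n, muln1, mul0n, muln0).
  rewrite (sum_delta _ ord_max (fun b => c (i - a + b).+2 *+ (a == 0 :> nat) *+ (j.+1 - b))).
  rewrite (sum_delta _ ord0 (fun b => c (j - b + a).+2 *+ (a == i :> nat) *+ (j.+1 - b))).
  rewrite /g1 /g2 /= subn0 subSnn mulrnDl mulr1n -!mulrnA.
  by congr (_ *+ _ + _ *+ _); lia.
rewrite big_split (sum_delta _ ord0 g1) (sum_delta _ ord_max g2) /g1 /g2 /=.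
by rewrite subn0 subSnn muln1 [(j + i)%N]addnC.
Qed.

#[local] Arguments mukai_word : simpl never.

Lemma mukai_eps (N : nat) (x y : chain A) :
  (forall w, ~~ reduced w -> x w = 0) -> (forall w, ~~ reduced w -> y w = 0) ->
  (forall k, (N < k)%N -> c k = 0) ->
  mukai x y = \sum_(i < N) \sum_(j < N)
    x (true, eps i) * y (true, eps j) * (c (i + j).+2 *+ (i + j).+2).
Proof.
move=> xred yred cN; rewrite /mukai (sum_word_pairs (M := N)).
  rewrite big_words; apply: eq_bigr => i _; rewrite !big_words -big_split /=.
  apply: eq_bigr => j _.
  by rewrite !mukai_word_1eps mukai_word_eps_1eps mukai_word_eps !mulr0 !addr0.
move=> [w1 w2] /= nz.
have red1 : reduced w1 by apply: contraR nz => /xred ->; rewrite !mul0r.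
have red2 : reduced w2 by apply: contraR nz => /yred ->; rewrite mulr0 mul0r.
rewrite red1 red2 /= andbC; move: nz; rewrite (reduced_eps red1) (reduced_eps red2) /=.
rewrite !size_nseq; move: (size w1.2) (size w2.2) => i j.
case: (w1.1) (w2.1) => -[]; rewrite ?mukai_word_1eps ?mukai_word_eps_1eps ?mulr0 ?eqxx //.
rewrite mukai_word_eps; have [ijN _|/cN ->] := leqP (i + j).+2 N.
  by apply/andP; split; lia.
by rewrite mul0rn mulr0 eqxx.
Qed.

End SuperpotentialChains.

(** On cochains the differential is again multiplication by F', in x = epsilon. *)
Lemma hoch_delta_eps (R : comNzRingType) (c : nat -> R)
    (psi : cochain (superpotential_algebra c)) k :
  (forall l s, false \in l -> psi l s = 0) ->
  (forall i, psi (eps i) false = 0) ->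
  hoch_delta false psi (eps k) false
  = \sum_(a < k.+1) psi (eps a) true * (c (k - a).+1 *+ (k - a).+1).
Proof.
move=> psi1 psi0; rewrite /hoch_delta size_nseq.
rewrite [X in _ - _ * X]big1 ?mulr0 ?subr0; last first.
  move=> j _; rewrite big1 // => i _; rewrite sum_idx slice_eps mu_eps.
  rewrite mulr0 mul0r add0r psi1 ?mulr0 //.
  by rewrite mem_cat inE eqxx orbT.
pose f a := psi (eps a) true * c (k - a).+1.
transitivity (\sum_(0 <= p < k.+1) \sum_(0 <= j < p.+1) f (p - j)%N).
  apply: eq_big_nat => p /andP[_ pk]; apply: eq_big_nat => j /andP[_ jp].
  rewrite sum_idx !slice_eps !take_eps !drop_eps psi0 mulr0 mul0r addr0 wpar_eps.
  rewrite koszul_swap_even expr0 mul1r cat_eps1 mu_eps /f.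
  by congr (psi (eps _) _ * c _); lia.
rewrite triangle_sum; apply: eq_bigr => a _; rewrite /f mulrnAr.
by rewrite subSn // -ltnS.
Qed.

(** * Power series and vector fields *)

Section PowerSeries.
Variables (n : nat) (A : comNzRingType).
Local Notation R := (mps n A).
Implicit Types (f g : R) (m : 'X_{1..n}) (v : 'I_n -> R).

(** A coefficient of a product depends on finitely many coefficients, so that
    identities for products of power series follow from those for polynomials. *)
Lemma mps_mulE f g m (p q : {mpoly A[n]}) :
  (forall k, (mdeg k <= mdeg m)%N -> f k = p@_k) ->
  (forall k, (mdeg k <= mdeg m)%N -> g k = q@_k) ->
  (f * g) m = (p * q)@_m.
Proof.
move=> fp gq; rewrite mcoeffM; apply: eq_bigr => k _.
by rewrite fp ?gq // -ltnS; apply: bmdeg.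
Qed.

Definition mps_trunc (d : nat) f : {mpoly A[n]} :=
  \sum_(m : 'X_{1..n < d.+1}) f m *: 'X_[m].

Lemma mps_truncE d f m : (mdeg m <= d)%N -> f m = (mps_trunc d f)@_m.
Proof. by move=> md; rewrite mcoeff_mpoly. Qed.

Lemma mps_sumE (I : Type) (r : seq I) (P : pred I) (F : I -> R) m :
  (\sum_(i <- r | P i) F i) m = \sum_(i <- r | P i) F i m.
Proof. by elim/big_rec2: _ => //= i y1 y2 _ <-. Qed.

Lemma mps_subE f g m : (f - g) m = f m - g m.
Proof. by []. Qed.

Lemma mpsC0 : mpsC n 0 = 0 :> R.
Proof. by apply: mpsP => m /=; case: eqP. Qed.

Lemma mpsC_mulE (a : A) f m : (mpsC n a * f) m = a * f m.
Proof.
rewrite (mps_mulE (p := a%:MP) (q := mps_trunc (mdeg m) f)).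
- by rewrite mcoeffCM -mps_truncE.
- by move=> k _; rewrite mcoeffC /= eq_sym; case: eqP; rewrite ?mulr1 ?mulr0.
- by move=> k /mps_truncE.
Qed.

Lemma mpsCD (a b : A) : mpsC n (a + b) = mpsC n a + mpsC n b :> R.
Proof. by apply: mpsP => m /=; case: eqP; rewrite ?addr0. Qed.

Lemma mpsCN (a : A) : mpsC n (- a) = - mpsC n a :> R.
Proof. by apply: mpsP => m /=; case: eqP; rewrite ?oppr0. Qed.

Lemma mpsCM (a b : A) : mpsC n (a * b) = mpsC n a * mpsC n b :> R.
Proof. by apply: mpsP => m; rewrite mpsC_mulE /=; case: eqP; rewrite ?mulr0. Qed.

Lemma mpsC_nat k : mpsC n k%:R = k%:R :> R.
Proof. by elim: k => [|k IHk]; rewrite ?mpsC0 // !mulrS mpsCD IHk. Qed.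

Lemma mps_mul0E f g : (f * g) 0%MM = f 0%MM * g 0%MM.
Proof.
rewrite (mps_mulE (p := (f 0%MM)%:MP) (q := (g 0%MM)%:MP)).
- by rewrite mcoeffCM mcoeffC eqxx mulr1.
- by move=> k; rewrite mdeg0 leqn0 mdeg_eq0 => /eqP ->; rewrite mcoeffC eqxx mulr1.
- by move=> k; rewrite mdeg0 leqn0 mdeg_eq0 => /eqP ->; rewrite mcoeffC eqxx mulr1.
Qed.

Lemma mps_mulX_derivE j f m : (mpsX A j * mps_deriv j f) m = f m *+ m j.
Proof.
case: (posnP (m j)) => [mj0|mj].
  rewrite mj0 mulr0n /GRing.mul /= big1 // => k /eqP mk.
  have /negbTE -> : k.1%MM != U_(j)%MM :> 'X_{1..n}.
    by apply: contra_eqN mk => /eqP ->; apply/eqP => /mnmP/(_ j); rewrite mnmDE mnm1E eqxx mj0.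
  by rewrite mul0r.
have jm : (U_(j) <= m)%MM.
  by apply/mnm_lepP => i; rewrite mnm1E; case: eqP => // <-.
rewrite -{1}(submK jm) addmC.
set m' := (m - U_(j))%MM.
rewrite (mps_mulE (p := 'X_[U_(j)]) (q := mps_trunc (mdeg (U_(j) + m')) (mps_deriv j f))).
- rewrite mulrC mcoeffMX -mps_truncE /=; last by rewrite mdegD leq_addl.
  by rewrite submK // /m' mnmBE mnm1E eqxx subn1 prednK.
- by move=> k _; rewrite mcoeffX eq_sym.
- by move=> k /mps_truncE.
Qed.

Lemma mps_derivD j f g : mps_deriv j (f + g) = mps_deriv j f + mps_deriv j g.
Proof. by apply: mpsP => m /=; rewrite mulrnDl. Qed.

Lemma mps_derivM j f g :
  mps_deriv j (f * g) = mps_deriv j f * g + f * mps_deriv j g.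
Proof.
apply: mpsP => m; pose d := (mdeg m).+1.
pose tf := mps_trunc d f; pose tg := mps_trunc d g.
have trE (h : R) (k : 'X_{1..n}) : (mdeg k <= mdeg m)%N -> h k = (mps_trunc d h)@_k.
  by move=> km; rewrite -mps_truncE // ltnW.
have trdE (h : R) (k : 'X_{1..n}) : (mdeg k <= mdeg m)%N ->
    mps_deriv j h k = ((mps_trunc d h)^`M(j))@_k.
  by move=> km; rewrite mcoeff_deriv -mps_truncE // mdegD mdeg1 addn1.
have -> : mps_deriv j (f * g) m = (f * g) (m + U_(j))%MM *+ (m j).+1 by [].
rewrite (mps_mulE (p := tf) (q := tg)).
- rewrite -mcoeff_deriv mderivM mcoeffD.
  by congr (_ + _); apply/esym/mps_mulE; [exact: trdE|exact: trE|exact: trE|exact: trdE].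
- by move=> k km; apply: mps_truncE; rewrite (leq_trans km) // mdegD mdeg1 addn1.
- by move=> k km; apply: mps_truncE; rewrite (leq_trans km) // mdegD mdeg1 addn1.
Qed.

Lemma mps_derivC j (a : A) : mps_deriv j (mpsC n a) = 0.
Proof.
apply: mpsP => m /=; case: eqP => [/mnmP/(_ j)|_]; last by rewrite mul0rn.
by rewrite mnmDE mnm1E eqxx mnm0E addn1.
Qed.

Lemma mps_derivX j k : mps_deriv j (mpsX A k) = mpsC n (j == k)%:R.
Proof.
apply: mpsP => m /=; case: (eqVneq m 0%MM) => [->|mn0].
  rewrite add0m mnm0E mulr1n; congr (nat_of_bool _)%:R.
  apply/eqP/eqP => [/mnmP/(_ j)|-> //]; rewrite !mnm1E eqxx.
  by case: eqP => // ->.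
case: eqP => [/(congr1 mdeg)|_]; last by rewrite mul0rn.
rewrite mdegD !mdeg1 addn1 => -[] /eqP; by rewrite mdeg_eq0 (negbTE mn0).
Qed.

Lemma mps_deriv_comm i j f :
  mps_deriv i (mps_deriv j f) = mps_deriv j (mps_deriv i f).
Proof.
apply: mpsP => m /=; rewrite -!mulrnA -!addmA [(U_(i) + _)%MM]addmC.
congr (_ *+ _); rewrite !mnmDE !mnm1E.
by rewrite [j == i]eq_sym; case: eqVneq => [->|_]; rewrite ?addn0 // mulnC.
Qed.

End PowerSeries.

Section VectorFields.
Variables (K : fieldType) (n : nat).
Local Notation R := (mps n K).
Implicit Types (f g : R) (m : 'X_{1..n}) (v w : vfield K n).

Lemma vapplyD v f g : vapply v (f + g) = vapply v f + vapply v g.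
Proof. by rewrite -big_split; apply: eq_bigr => j _; rewrite mps_derivD mulrDr. Qed.

Lemma vapplyC v (a : K) : vapply v (mpsC n a) = 0.
Proof. by rewrite /vapply big1 // => j _; rewrite mps_derivC mulr0. Qed.

Lemma vapply0 v : vapply v 0 = 0.
Proof. by have := vapplyD v 0 0; rewrite addr0 -{1}[vapply v 0]addr0 => /addrI. Qed.

Lemma vapply_nat v k : vapply v k%:R = 0.
Proof.
by elim: k => [|k IHk]; rewrite ?vapply0 // mulrS vapplyD IHk (vapplyC v 1) addr0.
Qed.

Lemma vapply_sum v (I : Type) (r : seq I) (P : pred I) (F : I -> R) :
  vapply v (\sum_(i <- r | P i) F i) = \sum_(i <- r | P i) vapply v (F i).
Proof. exact: (big_morph _ (vapplyD v) (vapply0 v)). Qed.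

Lemma vapplyM v f g : vapply v (f * g) = vapply v f * g + f * vapply v g.
Proof.
rewrite /vapply mulr_suml mulr_sumr -big_split; apply: eq_bigr => j _.
by rewrite mps_derivM /=; ring.
Qed.

Lemma vapplyX v j : vapply v (mpsX K j) = v j.
Proof.
rewrite /vapply (bigD1 j) //= mps_derivX eqxx mulr1 big1 ?addr0 // => k.
by move=> /negbTE kj; rewrite mps_derivX kj mpsC0 mulr0.
Qed.

Lemma vapply_comp v w f : vapply v (vapply w f)
  = vapply (fun k => vapply v (w k)) f
    + \sum_(j < n) \sum_(k < n) v j * w k * mps_deriv j (mps_deriv k f).
Proof.
rewrite [X in vapply v X]/vapply vapply_sum.
under eq_bigr do rewrite vapplyM.
rewrite big_split; congr (_ + _); rewrite exchange_big; apply: eq_bigr => k _ /=.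
by rewrite mulr_sumr; apply: eq_bigr => j _; rewrite mulrA [w k * _]mulrC.
Qed.

(** The second-order terms cancel because partial derivatives commute. *)
Lemma vapply_commutator v w f :
  vapply v (vapply w f) - vapply w (vapply v f)
  = vapply (fun k => vapply v (w k) - vapply w (v k)) f.
Proof.
rewrite !vapply_comp [X in _ - (_ + X)]exchange_big /=.
rewrite [X in _ - (_ + X)](eq_bigr (fun j =>
    \sum_(k < n) v j * w k * mps_deriv j (mps_deriv k f))); last first.
  move=> j _; apply: eq_bigr => k _; rewrite mps_deriv_comm; ring.
rewrite opprD addrACA subrr addr0 /vapply -sumrB; apply: eq_bigr => k _.
by rewrite mulrBl.
Qed.

Lemma vapply_euler (a : 'I_n -> K) f m :
  vapply (fun j => mpsC n (a j) * mpsX K j) f m = (\sum_(j < n) a j *+ m j) * f m.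
Proof.
rewrite /vapply mps_sumE mulr_suml; apply: eq_bigr => j _.
by rewrite -mulrA mpsC_mulE mps_mulX_derivE mulrnAr mulrnAl.
Qed.

Lemma mps_natmulE f k m : (f *+ k) m = f m *+ k.
Proof. by elim: k => // k IHk; rewrite !mulrS -IHk. Qed.

Lemma mps_mulrnI f k : [pchar K] =i pred0 -> (0 < k)%N -> f *+ k = 0 -> f = 0.
Proof.
move=> /pcharf0P charK k0 fk; apply: mpsP => m.
have /(congr1 (fun g : R => g m)) := fk; rewrite mps_natmulE => /eqP.
by rewrite -mulr_natr mulf_eq0 charK eqn0Ngt k0 orbF => /eqP.
Qed.

Lemma mps_const f : [pchar K] =i pred0 ->
  (forall j, mps_deriv j f = 0) -> f = mpsC n (f 0%MM).
Proof.
move=> /pcharf0P charK df; apply: mpsP => m /=; case: eqVneq => [-> //|].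
rewrite -mdeg_eq0 mdegE sum_nat_eq0 negb_forall => /existsP[j /= mj].
have jm : (U_(j) <= m)%MM.
  by apply/mnm_lepP => i; rewrite mnm1E; case: eqP => // <-; rewrite lt0n.
have /(congr1 (fun g : R => g (m - U_(j))%MM)) /= := df j.
rewrite submK // => /eqP; rewrite -mulr_natr mulf_eq0 charK orbF => /eqP //.
Qed.

End VectorFields.

Section Adic.
Variables (n : nat) (A : comNzRingType).
Local Notation R := (mps n A).
Implicit Types f g : R.

Lemma mps_adic_sum N (I : Type) (r : seq I) (P : pred I) (F : I -> R) :
  (forall i, P i -> mps_adic N (F i)) -> mps_adic N (\sum_(i <- r | P i) F i).
Proof. by move=> FN m mN; rewrite mps_sumE big1 // => i /FN ->. Qed.

Lemma mps_adicM N f g : mps_adic N f -> g 0%MM = 0 -> mps_adic N.+1 (f * g).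
Proof.
move=> fN g0 m mN; rewrite /GRing.mul /= big1 // => k /eqP mk.
case: (eqVneq (k.2 : 'X_{1..n}) 0%MM) => [->|]; first by rewrite g0 mulr0.
rewrite -mdeg_eq0 => k2; rewrite fN ?mul0r //.
by have := congr1 mdeg mk; rewrite mdegD; lia.
Qed.

Lemma mps_adic_eq0 f : (forall N, mps_adic N f) -> f = 0.
Proof. by move=> fN; apply: mpsP => m; apply: (fN (mdeg m).+1). Qed.

End Adic.

(** * The expansion of 1/F' at infinity *)

Section Coefficients.
Variables (K : fieldType) (n : nat).
Hypothesis charK : [pchar K] =i pred0.
Local Notation R := (mps n K).

Definition versal_coef (k : nat) : R :=
  if insub k is Some j then mpsX K (j : 'I_n)
  else if k == n.+1 then mpsC n n.+1%:R^-1 else 0.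

Definition dF_coef (j : nat) : R := versal_coef j.+1 *+ j.+1.

Lemma versal_coef_lt (j : 'I_n) : versal_coef j = mpsX K j.
Proof. by rewrite /versal_coef valK. Qed.

Lemma versal_coef_ge k : (n <= k)%N ->
  versal_coef k = if k == n.+1 then mpsC n n.+1%:R^-1 else 0.
Proof. by move=> nk; rewrite /versal_coef insubF // ltnNge nk. Qed.

Lemma versal_coef_gt k : (n.+1 < k)%N -> versal_coef k = 0.
Proof. by move=> nk; rewrite versal_coef_ge ?gtn_eqF //; lia. Qed.

Lemma dF_coef_gt j : (n < j)%N -> dF_coef j = 0.
Proof. by move=> nj; rewrite /dF_coef versal_coef_gt // mul0rn. Qed.

Lemma dF_coef_lead : dF_coef n = 1.
Proof.
rewrite /dF_coef versal_coef_ge // eqxx; apply: mpsP => m.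
rewrite mps_natmulE /=; case: eqP => _; last by rewrite mul0rn.
by rewrite -[_^-1 *+ _]mulr_natr mulVf // (pcharf0P K).1.
Qed.

Lemma dF_coef0 j : (j < n)%N -> dF_coef j 0%MM = 0.
Proof.
move=> jn; rewrite /dF_coef mps_natmulE; have [jn1|] := ltnP j.+1 n.
  rewrite (versal_coef_lt (Ordinal jn1)) /=; case: eqP => [/(congr1 mdeg)|].
    by rewrite mdeg0 mdeg1.
  by rewrite mul0rn.
by move=> nj; rewrite versal_coef_ge // ltn_eqF ?mul0rn.
Qed.

Lemma vapply_coef (v : vfield K n) k :
  vapply v (versal_coef k) = if insub k is Some j then v (j : 'I_n) else 0.
Proof.
rewrite /versal_coef; case: insubP => [j _ _|_]; first exact: vapplyX.
by case: eqP => _; rewrite ?vapplyC ?vapply0.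
Qed.

(** The expansion at infinity of 1/F' is sum_k z_k x^(-k-1) for the sequence z
    with these two properties. *)
Definition recip_dF (z : nat -> R) : Prop :=
  (forall k, (k < n)%N -> z k = (k == n.-1)%:R) /\
  (forall m, \sum_(j < n.+1) dF_coef j * z (m + j)%N = 0).

Lemma recip_dF_unique z z' : recip_dF z -> recip_dF z' -> z =1 z'.
Proof.
move=> [z0 zrec] [z0' zrec'] k; elim/ltn_ind: k => k IHk.
have [kn|nk] := ltnP k n; first by rewrite z0 ?z0'.
have := etrans (zrec (k - n)%N) (esym (zrec' (k - n)%N)); rewrite !big_ord_recr /=.
rewrite dF_coef_lead !mul1r subnK //.
suff -> : \sum_(j < n) dF_coef j * z (k - n + j)%N
  = \sum_(j < n) dF_coef j * z' (k - n + j)%N by exact: addrI.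
by apply: eq_bigr => j _; rewrite IHk //; have := ltn_ord j; lia.
Qed.

(** This is the residue of x^a x^b F'/(F')^2. The sum T a b depends on a + b only:
    enlarging it by the row or by the column of index 0, which vanish by the
    recursion for z, gives T a.+1 b and T a b.+1. *)
Lemma recip_dF_pairing z (n_gt0 : (0 < n)%N) : recip_dF z -> forall a b,
  \sum_(i < n.+1) \sum_(j < n.+1) z (a + i)%N * z (b + j)%N * dF_coef (i + j).+1
  = z (a + b)%N.
Proof.
move=> [z0 zrec].
pose T a b := \sum_(i < n.+1) \sum_(j < n.+1) z (a + i)%N * z (b + j)%N * dF_coef (i + j).+1.
have shift a b : \sum_(i < n.+2) \sum_(j < n.+2) z (a + i)%N * z (b + j)%N * dF_coef (i + j)
    = T a.+1 b.
  rewrite big_ord_recl /= [X in X + _](_ : _ = 0) ?add0r.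
    apply: eq_bigr => i _; rewrite big_ord_recr /= dF_coef_gt ?mulr0 ?addr0.
      by apply: eq_bigr => j _; rewrite addSnnS.
    by rewrite /bump; lia.
  rewrite big_ord_recr /= dF_coef_gt ?mulr0 ?addr0 //.
  transitivity (z (a + 0)%N * \sum_(j < n.+1) dF_coef j * z (b + j)%N).
    rewrite mulr_sumr; apply: eq_bigr => j _.
    by rewrite -mulrA [z (b + _)%N * _]mulrC.
  by rewrite zrec mulr0.
have T_sym a b : T a b = T b a.
  rewrite /T exchange_big; apply: eq_bigr => i _; apply: eq_bigr => j _.
  by rewrite [z (a + _)%N * _]mulrC [(j + i)%N]addnC.
have TS a b : T a.+1 b = T a b.+1.
  rewrite -shift [RHS]T_sym -shift exchange_big; apply: eq_bigr => i _.
  by apply: eq_bigr => j _; rewrite [z (a + _)%N * _]mulrC [(j + i)%N]addnC.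
have T0 b : T 0%N b = z b.
  rewrite /T (bigD1 (inord n.-1)) //= [X in _ + X]big1 ?addr0 => [|i].
    rewrite big_ord_recl [X in _ + X]big1 ?addr0 => [|j _]; last first.
      by rewrite dF_coef_gt ?mulr0 // inordK /= ?/bump /=; lia.
    rewrite inordK; last by lia.
    rewrite add0n !addn0 prednK // dF_coef_lead mulr1 z0; last by lia.
    by rewrite eqxx mul1r.
  rewrite -val_eqE /= inordK; last by lia.
  move=> i_n; rewrite big1 // => j _; have [lt_in|] := ltnP i n.
    by rewrite z0 // (negbTE i_n) !mul0r.
  by move=> ni; rewrite dF_coef_gt ?mulr0 //; lia.
move=> a b; rewrite -/(T a b); elim: a b => [|a IHa] b; first exact: T0.
by rewrite TS IHa addnS.
Qed.

End Coefficients.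

(** * The categorical primitive form *)

Section Categorical.
Variables (K : fieldType) (n : nat).
Hypotheses (charK : [pchar K] =i pred0) (n_gt0 : (0 < n)%N).
Local Notation R := (mps n K).
Local Notation A := (versal_An K n).
Local Notation c := (versal_coef K n).
Local Notation Fp := (dF_coef K n).
Implicit Types (v : vfield K n) (x : lchain A) (E : vfield K n).

Lemma mu_versal_eps k (s : bool) : mu A (eps k) s = if s then 0 else c k.
Proof. exact: (mu_eps c). Qed.

Definition euler_weight (k : nat) : K := 1 - k%:R / n.+1%:R.

(** In K[[t]][[x]] the hypothesis reads E(F) - F = psi F'. So h = psi + x/(n+1)
    satisfies h F' = E(F) - F + x F'/(n+1), a polynomial in x of degree less than n.
    As F' is x^n modulo the maximal ideal, the vanishing of the coefficients of
    x^(n+i) puts each h_i in every power of that ideal, hence h = 0: this is the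
    uniqueness in Weierstrass division. *)
Lemma euler_coef E : is_euler E -> forall k, vapply E (c k) = mpsC n (euler_weight k) * c k.
Proof.
case=> psi [psi1 psi_par dpsi].
have psi0 i : psi (eps i) false = 0.
  by apply: contrapT => /psi_par; rewrite (wpar_eps c).
pose q : R := mpsC n n.+1%:R^-1.
have qn : q *+ n.+1 = 1.
  apply: mpsP => m; rewrite mps_natmulE /=; case: eqP => _; last by rewrite mul0rn.
  by rewrite -[_^-1 *+ _]mulr_natr mulVf // (pcharf0P K).1.
have weightE k : mpsC n (euler_weight k) * c k = c k - q * (c k *+ k).
  apply: mpsP => m; rewrite mps_subE !mpsC_mulE mps_natmulE /euler_weight.
  by rewrite mulrBl mul1r mulrAC mulr_natl mulrC.
pose h i : R := psi (eps i) true + (if i == 1%N then q else 0).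
have hF k : \sum_(a < k.+1) h a * Fp (k - a) = vapply E (c k) - mpsC n (euler_weight k) * c k.
  have := dpsi (eps k) false; rewrite mem_nseq andbF => /(_ isT).
  rewrite weightE (hoch_delta_eps (c := c) _ psi1 psi0) /vmu mu_versal_eps => psiE.
  have -> : q * (c k *+ k) = \sum_(a < k.+1) (if a == 1%N :> nat then q else 0) * Fp (k - a).
    case: k {psiE} => [|k]; first by rewrite big_ord_recl big_ord0 /= mul0r mulr0 addr0.
    rewrite !big_ord_recl /= mul0r add0r big1 ?addr0 => [|i _]; last by rewrite mul0r.
    by rewrite /bump /= subSS subn0.
  under eq_bigr do rewrite mulrDl.
  by rewrite big_split /= -psiE; ring.
suff h0 i : h i = 0.
  move=> k; apply/eqP; rewrite -subr_eq0 -hF big1 // => i _.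
  by rewrite h0 mul0r.
apply: mps_adic_eq0 => N; elim: N i => [|N IHN] i; first by move=> m.
have big_k k : (n <= k)%N -> vapply E (c k) - mpsC n (euler_weight k) * c k = 0.
  move=> nk; rewrite vapply_coef insubF ?ltnNge ?nk // versal_coef_ge //.
  case: eqP => [->|_]; last by rewrite mulr0 subr0.
  by rewrite /euler_weight divff ?(pcharf0P K).1 // subrr mpsC0 mul0r subr0.
have := hF (n + i)%N; rewrite big_k ?leq_addr // => hFi.
have lt_i : (i < (n + i).+1)%N by lia.
move: hFi; rewrite (bigD1 (Ordinal lt_i)) //= addnK dF_coef_lead // mulr1.
move=> /eqP; rewrite addr_eq0 -sumrN => /eqP ->.
apply: mps_adic_sum => a; rewrite -val_eqE /= => ai.
rewrite -mulrN; have [lt_ai|] := ltnP a i.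
  by rewrite dF_coef_gt ?oppr0 ?mulr0 //; lia.
move=> ia; apply: mps_adicM; first exact: IHN.
by rewrite /= dF_coef0 ?oppr0 //; have := ltn_ord a; lia.
Qed.

Lemma euler_field E : is_euler E ->
  E = fun j => mpsC n (euler_weight j) * mpsX K j.
Proof.
move=> /euler_coef Ec; apply/funext => j.
by have := Ec j; rewrite versal_coef_lt vapplyX.
Qed.

Definition neg_reduced x : Prop :=
  (forall l : int, l < 0 -> forall w, x l w = 0) /\
  (forall l w, ~~ reduced w -> x l w = 0).

Lemma neg_cycle_reduced x : is_neg_cycle (@mps_adic n K) x -> neg_reduced x.
Proof. by case=> -[x0 xch] _; split=> // l; have [] := xch l. Qed.

Lemma unabla_reduced v x : neg_reduced x -> neg_reduced (unabla v x).
Proof.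
case=> x0 xred; split=> [l l0 w|l w redw]; rewrite /unabla /umul /nabla.
  have xz k : k <= l -> x k = (fun _ => 0).
    by move=> kl; apply/funext => w'; apply: x0; lia.
  rewrite subrK !xz //; last by lia.
  have ext0 op : extend (A := A) op (fun _ => 0) w = 0.
    by rewrite /extend; case: ifP => // _; rewrite fsbig1 // => i _; rewrite mul0r.
  by rewrite /b11 /B11 !ext0 vapply0 !subr0.
have ext0 op (y : chain A) : extend op y w = 0 by rewrite /extend (negbTE redw).
by rewrite /b11 /B11 !ext0 xred // vapply0 !subr0.
Qed.

Lemma unabla_eps v x k : neg_reduced x ->
  unabla v x 0 (true, eps k) = - \sum_(a < n) v a * x 0 (true, eps (k + a)).
Proof.
case=> x0 xred; rewrite /unabla /umul /nabla x0 // vapply0 sub0r.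
have -> : (0 - 1 + 1 : int) = 0 by [].
rewrite (B11_to_eps (c := c)) ?subr0; last exact: xred.
rewrite (b11_eps (c := c) (N := n)); first 1 last.
- exact: xred.
- by move=> i; rewrite /vmu mu_versal_eps vapply0.
- by move=> i ni; rewrite /vmu mu_versal_eps vapply_coef insubF // ltnNge ni.
congr (- _); apply: eq_bigr => a _.
by rewrite /vmu mu_versal_eps versal_coef_lt vapplyX.
Qed.

Section PrimitiveForm.
Variable zeta : lchain A.
Hypothesis zetaP : is_categorical_primitive_form zeta.
Let z (l : int) k : R := zeta l (true, eps k).
Let zred : neg_reduced zeta := neg_cycle_reduced (cpf_cycle zetaP).

(** The component at o_m u^l of the cycle equation. *)
Lemma cycle_eps l m :
  \sum_(j < n.+1) Fp j * z l (m + j)%N + z (l - 1) m.-1 *+ m = 0.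
Proof.
have [_ /(_ l (false, eps m))] := cpf_cycle zetaP; rewrite /b_uB.
rewrite (hoch_b_eps (c := c) (N := n.+1)); first 1 last.
- by move=> w; apply: zred.2.
- by move=> k; apply: versal_coef_gt.
by rewrite (connes_B_eps (c := c)) // => w; apply: zred.2.
Qed.

(** Boundaries have no e-component, hence the class of zeta at t = 0 determines its
    e-component there. *)
Lemma zeta_at0 k : z 0 k 0%MM = (k == n.-1)%:R.
Proof.
have [y [_ ych] /(_ 0 (true, eps k))] := cpf_P0 zetaP.
rewrite /b_uB hoch_b_to_eps ?connes_B_to_eps; first 1 last.
- by have [] := ych (0 - 1).
- by have [] := ych 0.
move/eqP; rewrite addr0 subr_eq0 => /eqP; rewrite /at0 /z => ->.
rewrite /omega /= big_ord0 expr0 !mul1r muln0 !addn0 xpair_eqE eqxx.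
by rewrite -/(eps _) eps_inj.
Qed.

(** The e-component of the homogeneity condition at u^0 involves the coefficient of
    u^1 only through (kappa(x)/2 - E(F)) z^1 = (1/(n+1) - 1/2) x F' z^1, which the
    cycle condition turns into a multiple of z^0. *)
Lemma primitive_form_homogeneous : exists r : K, exists2 E, is_euler E &
  forall k, vapply E (z 0 k) = mpsC n (r + k.+1%:R / n.+1%:R) * z 0 k.
Proof.
have [E EP [r [y [ych _] wtE]]] := cpf_P4 zetaP.
exists (r - 2%:R^-1), E => // k; have := wtE 0 (true, eps k).
rewrite /b_uB hoch_b_to_eps ?connes_B_to_eps; first 1 last.
- by have [] := ych (0 - 1).
- by have [] := ych 0.
rewrite /nabla_udu /umul /nabla_du /nabla.
have -> : (0 - 1 + 1 : int) = 0 by [].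
have -> : (0 - 1 + 2 : int) = 1 by [].
have -> : (0 + 1 : int) = 1 by [].
rewrite !(B11_to_eps (c := c)); first 1 last.
- exact: zred.2.
- exact: zred.2.
rewrite !(b11_eps (c := c) (N := n.+2)); first 1 last.
all: try exact: zred.2.
all: try by move=> i; rewrite ?/vmu ?/kappa mu_versal_eps ?vapply0 ?mulr0.
all: try by move=> i ni; rewrite ?/vmu ?/kappa mu_versal_eps versal_coef_gt ?vapply0 ?mulr0.
rewrite /gamma size_nseq -/(z 0 k) addr0.
set k_ := 1 *- k; pose q : R := mpsC n n.+1%:R^-1.
pose T := \sum_(i < n.+2) c i * z 1 (k + i).
pose S := \sum_(i < n.+2) c i *+ i * z 1 (k + i).
have -> : \sum_(i < n.+2) kappa (eps i) false * zeta 1 (true, eps (k + i)) = T *+ 2 - S.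
  rewrite /T /S -sumrMnl -sumrB; apply: eq_bigr => i _.
  by rewrite /kappa mu_versal_eps size_nseq /z; ring.
have -> : \sum_(i < n.+2) vmu E (eps i) false * zeta 1 (true, eps (k + i)) = T - q * S.
  rewrite /T /S mulr_sumr -sumrB; apply: eq_bigr => i _.
  rewrite /vmu mu_versal_eps (euler_coef EP) /z /euler_weight mpsCD mpsCN mpsCM mpsC_nat.
  by rewrite (_ : mpsC n 1 = 1) // -/q; ring.
have -> : S = - (z 0 k *+ k.+1).
  have := cycle_eps 1 k.+1; rewrite /= (_ : (1 - 1 : int) = 0) // => /eqP.
  rewrite addr_eq0 => /eqP <-; rewrite /S big_ord_recl mulr0n mul0r add0r.
  by apply: eq_bigr => j _; rewrite /dF_coef /bump /= addSnnS.
have half2 : mpsC n 2^-1 * 2%:R = 1 :> R.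
  by rewrite -mpsC_nat -mpsCM mulVf // (pcharf0P K).1.
rewrite {}/k_ !mpsCD mpsCN mpsCM mpsC_nat -/q mul0r add0r subr0 addr0.
set h := mpsC n 2^-1 in half2 *; set v := vapply E _; set x := z 0 k => hE.
apply/eqP; rewrite -subr_eq0.
have -> : v - (mpsC n r - h + k.+1%:R * q) * x
  = h * (1 *- k * x + (T *+ 2 - x *- k.+1)) + (v - (T - q * (x *- k.+1)))
    - mpsC n r * x + (1 - h * 2%:R) * T by ring.
by rewrite hE half2 subrr mul0r addr0.
Qed.

(** The coefficient of t^m in z_k can be non-zero only if the weight of t^m, which is
    positive for m non-zero, equals (k+1-n)/(n+1), which is at most 0 for k < n. *)
Lemma primitive_form_recip : recip_dF (z 0).
Proof.
split=> [k kn|m]; last first.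
  by have := cycle_eps 0 m; rewrite /z zred.1 // mul0rn addr0.
have [r [E EP wtE]] := primitive_form_homogeneous.
have coefE l (m : 'X_{1..n}) : (\sum_(j < n) euler_weight j *+ m j) * z 0 l m
    = (r + l.+1%:R / n.+1%:R) * z 0 l m.
  by rewrite -[RHS]mpsC_mulE -wtE (euler_field EP) vapply_euler.
have rE : r = - (n%:R / n.+1%:R).
  have := coefE n.-1 0%MM; rewrite zeta_at0 eqxx !mulr1 prednK // big1 => [/eqP|j _].
    by rewrite eq_sym addr_eq0 => /eqP.
  by rewrite mnm0E.
apply: mpsP => m; case: (eqVneq m 0%MM) => [->|m0].
  by rewrite zeta_at0; case: eqP => _ /=; rewrite ?eqxx.
rewrite [RHS](_ : _ = 0); last first.
  by case: eqP => _ //=; rewrite (negbTE m0).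
(* the weight of t^m, multiplied by n + 1 to make it a natural number *)
pose d := (\sum_(j < n) (n.+1 - j) * m j)%N.
have dE : d%:R = n.+1%:R * \sum_(j < n) euler_weight j *+ m j :> K.
  rewrite natr_sum mulr_sumr; apply: eq_bigr => j _.
  rewrite natrM natrB; last by rewrite ltnW // ltnS ltnW.
  rewrite -[X in _ = _ * X]mulr_natr mulrA /euler_weight mulrBr mulr1; congr ((_ - _) * _).
  by rewrite mulrC mulfVK // (pcharf0P K).1.
have d_gt0 : (0 < d)%N.
  move: m0; rewrite -mdeg_eq0 mdegE sum_nat_eq0 negb_forall => /existsP[j /= mj].
  rewrite lt0n sum_nat_eq0 negb_forall; apply/existsP; exists j => /=.
  by rewrite muln_eq0 (negbTE mj) orbF -lt0n; have := ltn_ord j; lia.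
have : (d + (n - k.+1))%N%:R * z 0 k m = 0.
  rewrite natrD natrB // dE mulrDl -mulrA coefE rE.
  by field; rewrite -[1]/(1%:R) -natrD (pcharf0P K).1.
move=> /eqP; rewrite mulf_eq0 (pcharf0P K).1 // => /orP[|/eqP //].
lia.
Qed.

(** Both arguments are multiples f/F' and g/F' of the class of zeta, and the pairing
    is the residue of f g/F'. *)
Lemma hres_contractions (x y : lchain A) (I J : finType) (a : I -> R) (b : J -> R)
    (e : I -> nat) (f : J -> nat) :
  neg_reduced x -> neg_reduced y ->
  (forall k, x 0 (true, eps k) = \sum_i a i * z 0 (e i + k)) ->
  (forall k, y 0 (true, eps k) = \sum_j b j * z 0 (f j + k)) ->
  hres x y 0 = \sum_i \sum_j a i * b j * z 0 (e i + f j).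
Proof.
move=> xred yred xE yE; rewrite /hres big_ord_recl big_ord0 expr0 mul1r addr0.
rewrite (mukai_eps (c := c) (N := n.+1)); first 1 last.
- exact: xred.2.
- exact: yred.2.
- by move=> k; apply: versal_coef_gt.
transitivity (\sum_(k < n.+1) \sum_(l < n.+1) \sum_i \sum_j
    a i * b j * (z 0 (e i + k) * z 0 (f j + l) * Fp (k + l).+1)).
  apply: eq_bigr => k _; apply: eq_bigr => l _.
  rewrite xE yE -/(Fp (k + l).+1) mulr_suml mulr_suml; apply: eq_bigr => i _.
  by rewrite mulr_sumr mulr_suml; apply: eq_bigr => j _; ring.
under eq_bigr do rewrite exchange_big.
rewrite exchange_big; apply: eq_bigr => i _ /=.
under eq_bigr do rewrite exchange_big.
rewrite exchange_big; apply: eq_bigr => j _ /=.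
rewrite -(recip_dF_pairing charK n_gt0 primitive_form_recip) mulr_sumr.
by apply: eq_bigr => k _; rewrite mulr_sumr.
Qed.

Lemma unabla_zeta_eps v k :
  unabla v zeta 0 (true, eps k) = \sum_(i < n) - v i * z 0 (i + k).
Proof.
rewrite (unabla_eps _ _ zred) -sumrN; apply: eq_bigr => i _.
by rewrite mulNr addnC.
Qed.

Lemma categorical_metric v w :
  metric (@unabla K n) (@hres _ A) zeta v w
  = \sum_(i < n) \sum_(j < n) v i * w j * z 0 (i + j).
Proof.
rewrite /metric (hres_contractions (unabla_reduced v zred) (unabla_reduced w zred)
  (unabla_zeta_eps v) (unabla_zeta_eps w)).
by apply: eq_bigr => i _; apply: eq_bigr => j _; rewrite mulrNN.
Qed.

Lemma categorical_threepoint v1 v2 v3 :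
  hres (unabla v1 (unabla v2 zeta)) (unabla v3 zeta) 0
  = - \sum_(i < n) \sum_(j < n) \sum_(k < n) v1 i * v2 j * v3 k * z 0 (i + j + k).
Proof.
have un2 l : unabla v1 (unabla v2 zeta) 0 (true, eps l)
    = \sum_(p : 'I_n * 'I_n) v1 p.1 * v2 p.2 * z 0 (p.1 + p.2 + l).
  rewrite (unabla_eps _ _ (unabla_reduced v2 zred)) -sumrN.
  rewrite -(pair_bigA _ (fun i j => v1 i * v2 j * z 0 (i + j + l))) /=.
  apply: eq_bigr => i _; rewrite unabla_zeta_eps -mulrN -sumrN mulr_sumr.
  apply: eq_bigr => j _; rewrite mulNr opprK mulrA; congr (_ * z 0 _).
  lia.
rewrite (hres_contractions (unabla_reduced v1 (unabla_reduced v2 zred))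
  (unabla_reduced v3 zred) un2 (unabla_zeta_eps v3)).
rewrite -(pair_bigA _ (fun i j => \sum_(k < n) v1 i * v2 j * - v3 k * z 0 (i + j + k))) /=.
rewrite -sumrN; apply: eq_bigr => i _; rewrite -sumrN; apply: eq_bigr => j _.
by rewrite -sumrN; apply: eq_bigr => k _; rewrite mulrN mulNr.
Qed.

End PrimitiveForm.
End Categorical.

(** * Residues *)

Section Saito.
Variables (K : fieldType) (n : nat).
Hypotheses (charK : [pchar K] =i pred0) (n_gt0 : (0 < n)%N).
Local Notation R := (mps n K).
Local Notation Rx := (mps n {poly K}).
Local Notation c := (versal_coef K n).
Local Notation Fp := (dF_coef K n).
Implicit Types (v : vfield K n) (g : Rx) (a : R).

Lemma toRx_mulE a (p : {poly K}) m : (toRx a * mpsC n p) m = (a m)%:P * p.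
Proof. by rewrite mulrC mpsC_mulE mulrC. Qed.

Lemma toRxC (r : K) : toRx (mpsC n r) = mpsC n r%:P.
Proof. by apply: mpsP => m /=; case: eqP. Qed.

Lemma toRxX (j : 'I_n) : toRx (mpsX K j) = mpsX {poly K} j.
Proof. by apply: mpsP => m /=; case: eqP. Qed.

Lemma unfoldingE : unfolding K n = \sum_(k < n.+2) toRx (c k) * mpsC n 'X^k.
Proof.
rewrite /unfolding !big_ord_recr /= !versal_coef_ge // ltn_eqF // eqxx.
rewrite (_ : toRx 0 = 0) ?mul0r ?addr0; last by rewrite -(mpsC0 n K) toRxC mpsC0.
rewrite toRxC [RHS]addrC.
congr (_ + _); first by rewrite -mpsCM mul_polyC.
by apply: eq_bigr => j _; rewrite versal_coef_lt toRxX.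
Qed.

Lemma ddx_unfolding :
  ddx (unfolding K n) = \sum_(j < n.+1) toRx (Fp j) * mpsC n 'X^j.
Proof.
apply: mpsP => m; rewrite unfoldingE mps_sumE /ddx /mps_map.
change (((\sum_(k < n.+2) toRx (c k) * mpsC n 'X^k) m)^`()
  = \sum_(j < n.+1) (toRx (Fp j) * mpsC n 'X^j) m).
rewrite mps_sumE (big_morph _ (@derivD K) (@deriv0 K)).
transitivity (\sum_(k < n.+2) c k m *: ('X^(k.-1) *+ k : {poly K})).
  by apply: eq_bigr => k _; rewrite toRx_mulE mul_polyC derivZ derivXn.
rewrite big_ord_recl mulr0n scaler0 add0r; apply: eq_bigr => j _.
by rewrite toRx_mulE mul_polyC /dF_coef mps_natmulE -scalerMnr scalerMnl.
Qed.

Definition bounded_deg (d : nat) g : Prop := forall m, (size (g m) <= d.+1)%N.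

Lemma bounded_deg_mul d e f g :
  bounded_deg d f -> bounded_deg e g -> bounded_deg (d + e) (f * g).
Proof.
move=> fd ge m; rewrite /GRing.mul /=.
apply: (leq_trans (size_sum _ _ _)); apply/bigmax_leqP => k _.
apply: (leq_trans (size_polyMleq _ _)).
rewrite (_ : (d + e).+1 = (d.+1 + e.+1) - 1)%N; last by lia.
by rewrite -subn1 leq_sub2r // leq_add // ?fd ?ge.
Qed.

Lemma bounded_deg_exp d i g : bounded_deg d g -> bounded_deg (i * d) (g ^+ i).
Proof.
move=> gd; elim: i => [|i IHi]; last by rewrite exprS mulSn; apply: bounded_deg_mul.
by move=> m; rewrite /=; case: eqP; rewrite ?size_poly1 ?size_poly0.
Qed.

(** Only the first term of the expansion of 1/F' in powers of Q = F' - x^n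
    contributes: the others have too small a degree in x. *)
Lemma residue_pow k : (k < n)%N ->
  residue (mpsC n 'X^k : Rx) = (k == n.-1)%:R.
Proof.
move=> kn; apply: mpsP => m; rewrite /residue; set Q := ddx _ - _.
have QE : Q = \sum_(j < n) toRx (Fp j) * mpsC n 'X^j.
  rewrite /Q ddx_unfolding big_ord_recr /= dF_coef_lead //.
  by rewrite (toRxC 1) mul1r addrK.
have Qdeg : bounded_deg n.-1 (- Q).
  move=> m'; rewrite QE.
  change (size (- (\sum_(j < n) toRx (Fp j) * mpsC n 'X^j) m') <= n.-1.+1)%N.
  rewrite size_polyN mps_sumE; apply: (leq_trans (size_sum _ _ _)).
  apply/bigmax_leqP => j _; rewrite toRx_mulE mul_polyC.
  apply: (leq_trans (size_scale_leq _ _)); rewrite size_polyXn.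
  by have := ltn_ord j; lia.
change (\sum_(i < (mdeg m).+1) ((mpsC n 'X^k * (- Q) ^+ i : Rx) m)`_(n * i.+1).-1
  = ((k == n.-1)%:R : R) m).
rewrite big_ord_recl expr0 mulr1 big1 => [|i _].
  rewrite addr0 muln1 /=; case: (eqVneq m 0%MM) => [->|m0].
    by rewrite coefXn eq_sym; case: eqP => _ /=; rewrite ?eqxx.
  by rewrite coef0; case: eqP => //= _; rewrite (negbTE m0).
have Xdeg : bounded_deg k (mpsC n 'X^k).
  by move=> m' /=; case: eqP => _; rewrite ?size_polyXn ?size_poly0.
have := bounded_deg_mul Xdeg (bounded_deg_exp i.+1 Qdeg) m.
move=> /leq_sizeP; apply; rewrite /= /bump leq0n add1n.
suff : forall q, (k < q.+1)%N -> (k + i.+1 * q < (q.+1 * i.+2).-1)%N.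
  by move=> /(_ n.-1); rewrite prednK //; apply.
by move=> q; rewrite !mulSn mulnS; lia.
Qed.

Section Pairing.
Variable P : useries K n -> useries K n -> nat -> R.
Hypothesis PP : is_higher_residue_pairing P.

Let const_useries g : useries K n := fun l => if l is 0 then g else 0.

(** Expressing the residue as the leading term of the pairing gives its linearity,
    and its vanishing on multiples of F'. *)
Lemma residueE g : residue g = P (const_useries g) (const_useries 1) 0.
Proof. by rewrite (shp_leading PP) mulr1. Qed.

Lemma residue_linear a g g' : residue (toRx a * g + g') = a * residue g + residue g'.
Proof.
rewrite !residueE -(shp_scalel PP) -(shp_addl PP).
congr (P _ _ _); apply/funext => -[|l] //=; by rewrite mulr0 addr0.
Qed.

Lemma residue0 : residue (0 : Rx) = 0.
Proof.
have := residue_linear 1 0 0; rewrite mulr0 addr0 mul1r.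
by move=> /eqP; rewrite -subr_eq0 opprD addNKr oppr_eq0 => /eqP.
Qed.

Lemma residue_sum (I : Type) (r : seq I) (a : I -> R) (g : I -> Rx) :
  residue (\sum_(i <- r) toRx (a i) * g i) = \sum_(i <- r) a i * residue (g i).
Proof.
elim: r => [|i r IHr]; first by rewrite !big_nil residue0.
by rewrite !big_cons residue_linear IHr.
Qed.

Definition monomial_residue (k : nat) : R := residue (mpsC n 'X^k : Rx).

Lemma residue_recip : recip_dF monomial_residue.
Proof.
split=> [k|m]; first exact: residue_pow.
rewrite -residue_sum.
have := shp_exactr PP (const_useries 1) (const_useries (- mpsC n 'X^m)) 0.
rewrite (shp_leading PP) /brieskorn_d /= mul1r sub0r mulrN opprK ddx_unfolding.
move=> <-; congr residue; rewrite mulr_suml; apply: eq_bigr => j _.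
by rewrite -mulrA -mpsCM -exprD addnC.
Qed.

Lemma residue_monomials (I : finType) (a : I -> R) (e : I -> nat) :
  residue (\sum_i toRx (a i) * mpsC n 'X^(e i)) = \sum_i a i * monomial_residue (e i).
Proof. exact: residue_sum. Qed.

(** This is v(F), by which u nabla_v acts at u = 0, up to sign. *)
Definition unfolding_along v : Rx := \sum_(j < n) toRx (v j) * mpsC n 'X^j.

Lemma toRxM a b : toRx (a * b) = toRx a * toRx b.
Proof.
apply: mpsP => m; rewrite /toRx /mps_map /GRing.mul /= rmorph_sum.
by apply: eq_bigr => k _; rewrite rmorphM.
Qed.

Lemma toRxN a : toRx (- a) = - toRx a.
Proof. by apply: mpsP => m; rewrite /= polyCN. Qed.

Lemma unfolding_along_mul v w : unfolding_along v * unfolding_along w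
  = \sum_(p : 'I_n * 'I_n) toRx (v p.1 * w p.2) * mpsC n 'X^(p.1 + p.2).
Proof.
rewrite -(pair_bigA _ (fun i j => toRx (v i * w j) * mpsC n 'X^(i + j))) /=.
rewrite /unfolding_along mulr_suml; apply: eq_bigr => i _; rewrite mulr_sumr.
by apply: eq_bigr => j _; rewrite toRxM exprD mpsCM mulrACA.
Qed.

Lemma saito_metric v w :
  metric (@saito_unabla K n) P (@saito_dx K n) v w
  = \sum_(i < n) \sum_(j < n) v i * w j * monomial_residue (i + j).
Proof.
rewrite /metric (shp_leading PP) /saito_unabla /= !sub0r !mulr1 mulrNN.
rewrite -/(unfolding_along v) -/(unfolding_along w) unfolding_along_mul residue_monomials.
by rewrite -(pair_bigA _ (fun i j => v i * w j * monomial_residue (i + j))).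
Qed.

Lemma saito_threepoint v1 v2 v3 :
  P (saito_unabla v1 (saito_unabla v2 (@saito_dx K n)))
    (saito_unabla v3 (@saito_dx K n)) 0
  = - \sum_(i < n) \sum_(j < n) \sum_(k < n)
        v1 i * v2 j * v3 k * monomial_residue (i + j + k).
Proof.
rewrite (shp_leading PP) /saito_unabla /= !sub0r !mulr1.
rewrite -/(unfolding_along v1) -/(unfolding_along v2) -/(unfolding_along v3).
set V1 := unfolding_along v1; set V2 := unfolding_along v2; set V3 := unfolding_along v3.
rewrite [X in residue X](_ : _ = - (V1 * V2 * V3)); last by ring.
have -> : - (V1 * V2 * V3) = \sum_(p : 'I_n * 'I_n * 'I_n)
    toRx (- (v1 p.1.1 * v2 p.1.2 * v3 p.2)) * mpsC n 'X^(p.1.1 + p.1.2 + p.2).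
  rewrite -(pair_bigA _ (fun q k => toRx (- (v1 q.1 * v2 q.2 * v3 k))
                               * mpsC n 'X^(q.1 + q.2 + k))) /=.
  rewrite unfolding_along_mul mulr_suml -sumrN; apply: eq_bigr => q _.
  rewrite /unfolding_along mulr_sumr -sumrN; apply: eq_bigr => k _.
  by rewrite toRxN !toRxM !exprD !mpsCM; ring.
rewrite residue_monomials.
rewrite -(pair_bigA _ (fun q k => - (v1 q.1 * v2 q.2 * v3 k)
                             * monomial_residue (q.1 + q.2 + k))) /=.
rewrite -(pair_bigA _ (fun i j => \sum_(k < n) - (v1 i * v2 j * v3 k)
                                           * monomial_residue (i + j + k))) /=.
rewrite -sumrN; apply: eq_bigr => i _; rewrite -sumrN; apply: eq_bigr => j _.
by rewrite -sumrN; apply: eq_bigr => k _; rewrite mulNr.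
Qed.

End Pairing.
End Saito.

(** * Uniqueness of flat frames *)

Section FlatFrames.
Variables (K : fieldType) (n : nat).
Hypothesis charK : [pchar K] =i pred0.
Local Notation R := (mps n K).
Implicit Types (tau : 'I_n -> R) (d : 'I_n -> vfield K n) (v w : vfield K n).

Lemma frame_dual tau d : is_coordinate_frame tau d ->
  forall j k, \sum_(i < n) mps_deriv j (tau i) * d i k = (j == k)%:R.
Proof.
move=> td j k; pose D : 'M[R]_n := \matrix_(i, l) d i l.
pose J : 'M[R]_n := \matrix_(l, i) mps_deriv l (tau i).
have DJ : D *m J = 1%:M.
  apply/matrixP => a b; rewrite !mxE -td; apply: eq_bigr => l _.
  by rewrite !mxE.
have /matrixP/(_ j k) := mulmx1C DJ; rewrite !mxE => <-.
by apply: eq_bigr => i _; rewrite !mxE.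
Qed.

Lemma frame_expand tau d : is_coordinate_frame tau d ->
  forall v j, v j = \sum_(i < n) vapply v (tau i) * d i j.
Proof.
move=> td v j; under eq_bigr do rewrite mulr_suml.
rewrite exchange_big /=.
under eq_bigr do (under eq_bigr do rewrite -mulrA; rewrite -mulr_sumr (frame_dual td)).
rewrite (bigD1 j) //= eqxx mulr1 big1 ?addr0 // => k /negbTE ->.
by rewrite mulr0.
Qed.

Lemma frame_derivE tau d : is_coordinate_frame tau d ->
  forall f j, mps_deriv j f = \sum_(i < n) mps_deriv j (tau i) * vapply (d i) f.
Proof.
move=> td f j; under eq_bigr do rewrite mulr_sumr.
rewrite exchange_big /=.
under eq_bigr do (under eq_bigr do rewrite mulrA; rewrite -mulr_suml (frame_dual td)).
rewrite (bigD1 j) //= eqxx mul1r big1 ?addr0 // => k; rewrite eq_sym => /negbTE ->.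
by rewrite mul0r.
Qed.

(** The commutator of d a and d b kills the coordinates, whose differentials form a
    basis. *)
Lemma frame_comm tau d : is_coordinate_frame tau d ->
  forall a b f, vapply (d a) (vapply (d b) f) = vapply (d b) (vapply (d a) f).
Proof.
move=> td a b f; apply/eqP; rewrite -subr_eq0 vapply_commutator.
set w := (fun k => _); rewrite /vapply big1 // => j _.
rewrite (frame_expand td w) big1 ?mul0r // => i _.
by rewrite -vapply_commutator !td !vapply_nat subrr mul0r.
Qed.

Section Metric.
Variables (h : nat -> R) (M : vfield K n -> vfield K n -> R).
Hypothesis ME : forall v w, M v w = \sum_(i < n) \sum_(j < n) v i * w j * h (i + j).
Hypothesis h0 : forall k, (k <= (n.-1).*2)%N -> h k 0%MM = (k.+1 == n)%:R.

Record flat_frame tau d : Prop := FlatFrame {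
  flat_linear : forall k j, tau k U_(j)%MM = - (k == j)%:R;
  flat_dual : is_coordinate_frame tau d;
  flat_const : forall i j, exists c : K, M (d i) (d j) = mpsC n c
}.

Lemma deriv_tau0 tau d : flat_frame tau d ->
  forall j k, mps_deriv j (tau k) 0%MM = - (j == k)%:R.
Proof. by move=> [lin _ _] j k; rewrite /= add0m mnm0E mulr1n lin eq_sym. Qed.

Lemma frame_at0 tau d : flat_frame tau d ->
  forall i k, d i k 0%MM = - (i == k)%:R.
Proof.
move=> td i k; have /(congr1 (fun f : R => f 0%MM)) := flat_dual td i k.
rewrite /vapply mps_sumE (bigD1 k) // big1 => [|j jk].
  rewrite mps_mul0E (deriv_tau0 td) eqxx mulrN1 /= addr0 => /eqP.
  by rewrite eqr_oppLR => /eqP ->; case: eqP => _; rewrite /= ?eqxx.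
by rewrite mps_mul0E (deriv_tau0 td) (negbTE jk) oppr0 mulr0.
Qed.

(** The metric is constant in a flat frame, and at t = 0 the frame is -d/dt_i. *)
Lemma metric_frame tau d : flat_frame tau d ->
  forall i j, M (d i) (d j) = ((i + j).+1 == n)%:R.
Proof.
move=> td i j; have [c Mc] := flat_const td i j.
suff -> : ((i + j).+1 == n)%:R = mpsC n (M (d i) (d j) 0%MM) by rewrite Mc /= eqxx.
have -> : M (d i) (d j) 0%MM = ((i + j).+1 == n)%:R.
  rewrite ME mps_sumE.
  under eq_bigr do (rewrite mps_sumE; under eq_bigr do
    rewrite !mps_mul0E !(frame_at0 td) mulrNN).
  rewrite (bigD1 i) //= [X in _ + X]big1 ?addr0 => [|k ki]; last first.
    by rewrite big1 // => l _; rewrite [i == k]eq_sym (negbTE ki) !mul0r.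
  rewrite (bigD1 j) //= [X in _ + X]big1 ?addr0 => [|k kj]; last first.
    by rewrite [j == k]eq_sym (negbTE kj) mulr0 mul0r.
  rewrite !eqxx !mul1r h0 //; have := ltn_ord i; have := ltn_ord j; lia.
by case: eqP => // _; rewrite mpsC0.
Qed.

Lemma metric_coord tau d : flat_frame tau d -> forall v w,
  M v w = \sum_(i < n) vapply v (tau i) * vapply w (tau (rev_ord i)).
Proof.
move=> td v w; rewrite ME.
pose V i := vapply v (tau i); pose W i := vapply w (tau i).
transitivity (\sum_(a < n) \sum_(b < n) V a * W b * M (d a) (d b)); last first.
  apply: eq_bigr => a _; rewrite (bigD1 (rev_ord a)) //= (metric_frame td).
  have -> : (a + rev_ord a).+1 = n by rewrite /=; have := ltn_ord a; lia.
  rewrite eqxx mulr1 big1 ?addr0 // => b; rewrite -val_eqE /= (metric_frame td) => ba.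
  suff -> : ((a + b).+1 == n) = false by rewrite mulr0.
  by apply: contra_neqF ba => /eqP; have := ltn_ord a; lia.
under [RHS]eq_bigr do (under eq_bigr do rewrite ME mulr_sumr; rewrite exchange_big).
rewrite [RHS]exchange_big; apply: eq_bigr => i _.
rewrite [LHS](eq_bigr (fun j => \sum_(a < n) \sum_(b < n)
   V a * W b * (d a i * d b j * h (i + j)))); last first.
  move=> j _; rewrite (frame_expand (flat_dual td) v) (frame_expand (flat_dual td) w).
  rewrite mulr_suml mulr_suml; apply: eq_bigr => a _.
  rewrite mulr_sumr mulr_suml; apply: eq_bigr => b _; rewrite /V /W /=; ring.
rewrite [LHS]exchange_big; apply: eq_bigr => a _ /=.
by rewrite [LHS]exchange_big; apply: eq_bigr => b _; rewrite -mulr_sumr.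
Qed.

(** Let J be the matrix of the second frame in the first one. Differentiating the
    orthogonality relation of J shows that S e a b, the pairing of the derivative of
    J_a along d' e with J_b, is antisymmetric in a and b; as the second frame consists
    of commuting fields, S is symmetric in e and a. Hence S = 0, so J is constant,
    and J is the identity at t = 0. *)
Lemma flat_frame_unique tau d tau' d' :
  flat_frame tau d -> flat_frame tau' d' -> d = d'.
Proof.
move=> td td'; pose J a i := vapply (d' a) (tau i).
have JJ a b : \sum_(i < n) J a i * J b (rev_ord i) = ((a + b).+1 == n)%:R.
  by rewrite -(metric_coord td) (metric_frame td').
pose S e a b := \sum_(i < n) vapply (d' e) (J a i) * J b (rev_ord i).
have S_sym e a b : S e a b = S a e b.
  by apply: eq_bigr => i _; rewrite /J (frame_comm (flat_dual td')).
have S_anti e a b : S e a b = - S e b a.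
  have := vapply_nat (d' e) (((a + b).+1 == n)%N).
  rewrite -JJ vapply_sum; under eq_bigr do rewrite vapplyM.
  rewrite big_split /= => /eqP; rewrite addr_eq0 => /eqP e_ab.
  rewrite [LHS]e_ab; congr (- _); rewrite /S [LHS](reindex_inj rev_ord_inj).
  apply: eq_bigr => i _ /=.
  by rewrite rev_ordK mulrC.
have S0 e a b : S e a b = 0.
  apply: (mps_mulrnI charK (k := 2)) => //; rewrite mulr2n.
  by rewrite {1}S_anti S_sym S_anti S_sym S_anti S_sym !opprK addNr.
have J_inv i k : \sum_(b < n) J (rev_ord b) (rev_ord i) * J b k = (i == k)%:R.
  pose P : 'M[R]_n := \matrix_(a, i) J a i.
  pose Q : 'M[R]_n := \matrix_(i, b) J (rev_ord b) (rev_ord i).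
  have PQ : P *m Q = 1%:M.
    apply/matrixP => a b; rewrite !mxE.
    under eq_bigr do rewrite !mxE.
    rewrite JJ -val_eqE /=; congr (nat_of_bool _)%:R.
    by have := ltn_ord a; have := ltn_ord b; lia.
  have /matrixP/(_ i k) := mulmx1C PQ; rewrite !mxE => <-.
  by apply: eq_bigr => b _; rewrite !mxE.
have dJ0 e a k : vapply (d' e) (J a k) = 0.
  transitivity (\sum_(i < n) vapply (d' e) (J a i) * (i == k)%:R).
    rewrite (bigD1 k) //= eqxx mulr1 big1 ?addr0 // => i /negbTE ->.
    by rewrite mulr0.
  under eq_bigr do rewrite -J_inv mulr_sumr.
  rewrite exchange_big big1 // => b _.
  under eq_bigr do rewrite mulrA.
  by rewrite -mulr_suml -/(S e a (rev_ord b)) S0 mul0r.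
have JE a k : J a k = (a == k)%:R.
  have -> : J a k = mpsC n (J a k 0%MM).
    apply: mps_const => // j; rewrite (frame_derivE (flat_dual td')).
    by rewrite big1 // => i _; rewrite dJ0 mulr0.
  rewrite /J /vapply mps_sumE (bigD1 k) // big1 => [|j jk].
    rewrite mps_mul0E (deriv_tau0 td) (frame_at0 td') eqxx mulrNN mulr1 /= addr0.
    by case: eqP => // _; rewrite mpsC0.
  by rewrite mps_mul0E (deriv_tau0 td) (negbTE jk) oppr0 mulr0.
apply/funext => a; apply/funext => j.
rewrite (frame_expand (flat_dual td) (d' a)) (bigD1 a) //= big1 => [|k ka].
  by rewrite -/(J a a) JE eqxx mul1r addr0.
by rewrite -/(J a k) JE eq_sym (negbTE ka) mul0r.
Qed.

End Metric.
End FlatFrames.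

(** * Comparison of the invariants *)
Lemma foldr_eq_last3 (I T : Type) (g : I -> T -> T) (x y : T) :
  (forall i j k, g i (g j (g k x)) = g i (g j (g k y))) ->
  forall s, (2 < size s)%N -> foldr g x s = foldr g y s.
Proof.
move=> gxy; elim=> [//|i [|j [|k [|l s]]]] IHs // _; first exact: gxy.
by rewrite /= in IHs *; rewrite IHs.
Qed.

Lemma correlator_eq (K : fieldType) (n : nat) (H H' : Type)
    (un : vfield K n -> H -> H) (un' : vfield K n -> H' -> H')
    (pair : H -> H -> nat -> mps n K) (pair' : H' -> H' -> nat -> mps n K)
    (z : H) (z' : H') (d : 'I_n -> vfield K n) (F F' : mps n K) (s : seq 'I_n) :
  (forall v w, metric un pair z v w = metric un' pair' z' v w) ->
  (forall v1 v2 v3, pair (un v1 (un v2 z)) (un v3 z) 0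
                  = pair' (un' v1 (un' v2 z')) (un' v3 z') 0) ->
  is_potential un pair z d F -> is_potential un' pair' z' d F' ->
  (1 < size s)%N ->
  correlator un pair z d F s = correlator un' pair' z' d F' s.
Proof.
move=> gE cE FP FP' s_gt1; rewrite /correlator.
have E : (2 < size s)%N ->
    foldr (fun i => vapply (d i)) F s = foldr (fun i => vapply (d i)) F' s.
  by apply: foldr_eq_last3 => i j k; rewrite FP FP' cE.
case: s s_gt1 E => [|i [|j [|k s]]] s_gt1 E.
- discriminate s_gt1.
- discriminate s_gt1.
- by rewrite gE.
- exact: (congr1 (fun f : mps n K => f 0%MM) (E isT)).
Qed.

Theorem theorem4p5 (K : fieldType) (n : nat)
  (charK : [pchar K] =i pred0) (n_gt0 : (0 < n)%N)
  (zeta : lchain (versal_An K n)) (zetaP : is_categorical_primitive_form zeta)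
  (tau : 'I_n -> mps n K) (d : 'I_n -> vfield K n)
  (tauP : is_flat_coordinates (@unabla K n) (@hres _ (versal_An K n)) zeta tau d)
  (F : mps n K)
  (FP : is_potential (@unabla K n) (@hres _ (versal_An K n)) zeta d F)
  (P : useries K n -> useries K n -> nat -> mps n K)
  (PP : is_higher_residue_pairing P)
  (tau' : 'I_n -> mps n K) (d' : 'I_n -> vfield K n)
  (tauP' : is_flat_coordinates (@saito_unabla K n) P (@saito_dx K n) tau' d')
  (F' : mps n K)
  (FP' : is_potential (@saito_unabla K n) P (@saito_dx K n) d' F')
  (m : nat) (m_ge2 : (2 <= m)%N) (i : m.-tuple 'I_n) :
  correlator (@unabla K n) (@hres _ (versal_An K n)) zeta d F i
  = correlator (@saito_unabla K n) P (@saito_dx K n) d' F' i.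
Proof.
have cat_recip := primitive_form_recip charK n_gt0 zetaP.
have saito_recip := residue_recip charK n_gt0 PP.
have resE := recip_dF_unique charK cat_recip saito_recip.
have gE v w : metric (@unabla K n) (@hres _ (versal_An K n)) zeta v w
    = metric (@saito_unabla K n) P (@saito_dx K n) v w.
  rewrite (categorical_metric charK n_gt0 zetaP) (saito_metric PP).
  by apply: eq_bigr => k _; apply: eq_bigr => l _; rewrite resE.
have cE v1 v2 v3 : hres (unabla v1 (unabla v2 zeta)) (unabla v3 zeta) 0
    = P (saito_unabla v1 (saito_unabla v2 (@saito_dx K n)))
        (saito_unabla v3 (@saito_dx K n)) 0.
  rewrite (categorical_threepoint charK n_gt0 zetaP) (saito_threepoint PP).
  congr (- _); apply: eq_bigr => k _; apply: eq_bigr => l _.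
  by apply: eq_bigr => a _; rewrite resE.
have dd' : d = d'.
  have [tau0 lin frame const] := tauP; have [tau0' lin' frame' const'] := tauP'.
  pose M := metric (@unabla K n) (@hres _ (versal_An K n)) zeta.
  have fr : flat_frame M tau d by split.
  have fr' : flat_frame M tau' d'.
    split; [exact: lin' | exact: frame' | move=> k l].
    have [a ga] := const' k l; exists a.
    rewrite /M gE; exact: ga.
  apply: (flat_frame_unique charK (categorical_metric charK n_gt0 zetaP) _ fr fr').
  by move=> k _; rewrite (zeta_at0 zetaP); congr (nat_of_bool _)%:R; lia.
move: FP'; rewrite -dd' => FP'.
by apply: (correlator_eq gE cE FP FP'); rewrite size_tuple.
Qed.
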